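(* Let $T^+,T^-:\mathbf{C}\to\mathbf{L}_\infty$ be linear positive operators and put $\mathcal{A}=(b-a)\|T^+\|_{\mathbf{C}\to\mathbf{L}_\infty}$, $\mathcal{B}=(b-a)\|T^-\|_{\mathbf{C}\to\mathbf{L}_\infty}$. Suppose that $$(\mathcal{B}^2-\mathcal{A}^2)\,t^2+(\mathcal{A}^2-\mathcal{B}^2+\mathcal{B})\,t+1-\mathcal{A}>0\quad\text{for all } t\in[0,1].$$ Let $F:\mathbf{C}\to\mathbf{L}_\infty$ be a (not necessarily linear) continuous operator which is bounded, i.e. maps bounded sets into bounded sets, and which satisfies $$\lim_{\|x\|_{\mathbf{C}}\to\infty}\frac{\|Fx\|_{\mathbf{L}_\infty}}{\|x\|_{\mathbf{C}}}=0.$$ Then, for $c\in\mathbb{R}$, the Cauchy problem $$\dot x(t)=(T^+x)(t)-(T^-x)(t)+(Fx)(t),\quad t\in[a,b],\qquad x(a)=c,$$ has a solution.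
   Context: Fix real numbers $a<b$. $\mathbf{C}=\mathbf{C}[a,b]$ is the Banach space of continuous functions $x:[a,b]\to\mathbb{R}$ with the max norm; $\mathbf{L}_\infty=\mathbf{L}_\infty[a,b]$ is the Banach space of essentially bounded measurable functions with the essential supremum norm; $\mathbf{AC}=\mathbf{AC}[a,b]$ is the space of absolutely continuous functions. A linear operator $T:\mathbf{C}\to\mathbf{L}_\infty$ is positive if it maps each non-negative continuous function to an almost everywhere non-negative function; with $\mathbf{1}(t)\equiv1$ its norm is $\|T\|_{\mathbf{C}\to\mathbf{L}_\infty}=\operatorname{ess\,sup}_{t\in[a,b]}(T\mathbf{1})(t)$. A solution of the Cauchy problem is a function $x\in\mathbf{AC}$ with $x(a)=c$ satisfying the equation almost everywhere on $[a,b]$. *)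

(* Defs.v *)
From HB Require Import structures.
From mathcomp Require Import all_boot all_order all_algebra.
From mathcomp Require Import all_classical all_reals all_analysis.
From mathcomp Require Import ess_sup_inf measurable_realfun.

Set Implicit Arguments.
Unset Strict Implicit.
Unset Printing Implicit Defensive.

Import Order.TTheory GRing.Theory Num.Theory.
Import numFieldNormedType.Exports.

Local Open Scope classical_set_scope.
Local Open Scope ring_scope.

Section Cab.
Context {R : realType} (a b : R).

(* A function [a, b] -> R is encoded, as by the library's restriction f \_ A,
   by the total function that agrees with it on [a, b] and is 0 elsewhere;
   this makes Leibniz equality of such functions equality on [a, b]. *)
Definition Cab_pred : {pred R -> R} := mem [set f : R -> R |
  {within `[a, b], continuous f} /\ forall t, t \notin `[a, b] -> f t = 0].

Lemma Cab_predP (f : R -> R) : f \in Cab_pred <->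
  {within `[a, b], continuous f} /\ forall t, t \notin `[a, b] -> f t = 0.
Proof. by rewrite inE. Qed.

Lemma Cab_submod_closed : submod_closed Cab_pred.
Proof.
split=> [|k f g /Cab_predP[cf f0] /Cab_predP[cg g0]]; apply/Cab_predP.
  by split=> //; apply: continuous_subspaceT => t; exact: cst_continuous.
split; last first.
  move=> t tab; change (k * f t + g t = 0).
  by rewrite f0// g0// mulr0 addr0.
move=> t; apply: cvgD; last exact: cg.
by apply: cvgM; [exact: cvg_cst|exact: cf].
Qed.

HB.instance Definition _ :=
  GRing.isSubmodClosed.Build R (R -> R) Cab_pred Cab_submod_closed.

Record Cab := MkCab { Cab_fun :> R -> R; CabP : Cab_fun \in Cab_pred }.

HB.instance Definition _ := [isSub for Cab_fun].
HB.instance Definition _ := gen_eqMixin Cab.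
HB.instance Definition _ := gen_choiceMixin Cab.
HB.instance Definition _ := [SubChoice_isSubLmodule of Cab by <:].

Implicit Types x y : Cab.

Lemma Cab_eq x y : (x : R -> R) =1 y -> x = y.
Proof. by move=> xy; apply/val_inj/funext. Qed.

Lemma Cab_continuous x : {within `[a, b], continuous x}.
Proof. by have /Cab_predP[] := CabP x. Qed.

Lemma Cab_out x t : t \notin `[a, b] -> x t = 0.
Proof. by have /Cab_predP[_] := CabP x; exact. Qed.

Lemma CabD x y t : (x + y) t = x t + y t. Proof. by []. Qed.

Lemma CabZ k x t : (k *: x) t = k * x t. Proof. by []. Qed.

Lemma Cab0 t : (0 : Cab) t = 0. Proof. by []. Qed.

Definition Cab_norm x : R := sup [set `|x t| | t in `[a, b]].

Lemma Cab_has_ubound x : has_ubound [set `|x t| | t in `[a, b]].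
Proof.
have [ab|ba] := leP a b; last first.
  exists 0 => r [t]; rewrite /= in_itv/= => /andP[a_t t_b] _.
  by have := lt_le_trans ba (le_trans a_t t_b); rewrite ltxx.
have cx : {within `[a, b], continuous (fun t => `|x t|)}.
  by move=> t; apply: cvg_norm; exact: Cab_continuous.
have [c _ xc] := EVT_max ab cx.
by exists `|x c| => _ [t tab <-]; exact: xc.
Qed.

Lemma Cab_normP x (M : R) : 0 <= M ->
  Cab_norm x <= M <-> forall t, t \in `[a, b] -> `|x t| <= M.
Proof.
move=> M0; split=> [xM t tab|xM].
  apply: le_trans xM; apply: ub_le_sup; first exact: Cab_has_ubound.
  by exists t.
rewrite /Cab_norm; set A := [set _ | _ in _].
have [->|/set0P ne] := eqVneq A set0; first by rewrite sup0.
by apply: ge_sup => // _ [t tab <-]; exact: xM.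
Qed.

Lemma Cab_norm_ge0 x : 0 <= Cab_norm x.
Proof.
rewrite /Cab_norm; set A := [set _ | _ in _].
have [->|/set0P[_ [t tab _]]] := eqVneq A set0; first by rewrite sup0.
apply: (@le_trans _ _ `|x t|) => //.
by apply: ub_le_sup; [exact: Cab_has_ubound|exists t].
Qed.

Lemma Cab_le_norm x t : `|x t| <= Cab_norm x.
Proof.
have [tab|tab] := boolP (t \in `[a, b]).
  by move: t tab; apply/Cab_normP => //; exact: Cab_norm_ge0.
by rewrite Cab_out// normr0 Cab_norm_ge0.
Qed.

Lemma Cab_normD x y : Cab_norm (x + y) <= Cab_norm x + Cab_norm y.
Proof.
apply/Cab_normP => [|t _]; first by rewrite addr_ge0 ?Cab_norm_ge0.
by rewrite CabD (le_trans (ler_normD _ _))// lerD ?Cab_le_norm.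
Qed.

Lemma Cab_normZ (k : R) x : Cab_norm (k *: x) = `|k| * Cab_norm x.
Proof.
have le (l : R) y : Cab_norm (l *: y) <= `|l| * Cab_norm y.
  apply/Cab_normP => [|t _]; first by rewrite mulr_ge0 ?Cab_norm_ge0.
  by rewrite CabZ normrM ler_wpM2l ?Cab_le_norm.
apply/eqP; rewrite eq_le le/=; have [->|k0] := eqVneq k 0.
  by rewrite normr0 mul0r Cab_norm_ge0.
rewrite -ler_pdivlMl ?normr_gt0// -normfV.
by rewrite -[X in Cab_norm X <= _](scalerK k0) le.
Qed.

Lemma Cab_norm0_eq0 x : Cab_norm x = 0 -> x = 0.
Proof.
move=> x0; apply: Cab_eq => t; rewrite Cab0; apply/eqP.
by rewrite -normr_le0 -x0 Cab_le_norm.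
Qed.

HB.instance Definition _ :=
  Lmodule_isNormed.Build R Cab Cab_normD Cab_normZ Cab_norm0_eq0.

Lemma Cab_normE x : `|x| = sup [set `|x t| | t in `[a, b]].
Proof. by []. Qed.

Lemma Cab_norm_max x : a <= b -> exists2 t, t \in `[a, b] & `|x| = `|x t|.
Proof.
move=> ab; have cx : {within `[a, b], continuous (fun t => `|x t|)}.
  by move=> t; apply: cvg_norm; exact: Cab_continuous.
have [c cab xc] := EVT_max ab cx; exists c => //.
by apply/eqP; rewrite eq_le Cab_le_norm andbT; apply/Cab_normP.
Qed.

Lemma Cab_one_subproof : (cst 1 : R -> R) \_ `[a, b] \in Cab_pred.
Proof.
apply/Cab_predP; split=> [|t tab]; last first.
  by rewrite patchE ifF//; apply/negbTE; rewrite notin_setE /=; exact/negP.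
apply: (@subspace_eq_continuous _ _ _ (cst 1 : subspace `[a, b]%classic -> R)).
  by move=> t tab; rewrite /from_subspace patchE tab.
by apply: continuous_subspaceT => t; exact: cst_continuous.
Qed.

Definition Cab_one : Cab := MkCab Cab_one_subproof.

End Cab.

Section Linfty.
Context {R : realType} (a b : R).

(* "Almost everywhere" for this measure means "almost everywhere on [a, b]",
   whatever happens outside [a, b]. *)
Definition mu_ab : {measure set (measurableTypeR R) -> \bar R} :=
  mrestr lebesgue_measure (measurable_itv `[a, b]).

#[export] Instance mu_ab_ae_filter : Filter (almost_everywhere mu_ab).
Proof. exact: (ae_filter_ringOfSetsType mu_ab). Qed.

#[export] Instance mu_ab_ae_filter_nbhs :
  Filter (nbhs (almost_everywhere mu_ab)).
Proof. exact: (ae_filter_ringOfSetsType mu_ab). Qed.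

(* The library's L^oo space of classes modulo equality almost everywhere, which
   comes without algebraic structure; an element coerces to a representative, so
   its values X t are only meaningful almost everywhere. *)
Definition Linfty : Type := LspaceType mu_ab (leey 1%E).

Lemma Lnorm_mu_ab_le (f : R -> R) (M : R) : 0 <= M ->
  ('N[mu_ab]_+oo[EFin \o f] <= M%:E)%E <-> \forall t \ae mu_ab, `|f t| <= M.
Proof.
move=> M0; rewrite unlock /Lnorm; case: ifPn => mu0.
  have fP := @ess_supP _ _ _ mu_ab (abse \o (EFin \o f)) M%:E.
  split => [/fP fM|fM]; last by apply/fP; apply: (filterS _ fM) => t.
  by apply: (filterS _ fM) => t.
split=> [_|_]; last by rewrite lee_fin.
apply: (measure0_ae (mu := mu_ab)).
by apply/eqP; rewrite eq_le measure_ge0 andbT leNgt.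
Qed.

Lemma finite_norm_mu_abP (f : R -> R) : finite_norm mu_ab +oo%E f <->
  exists2 M : R, 0 <= M & \forall t \ae mu_ab, `|f t| <= M.
Proof.
rewrite /finite_norm; split=> [fy|[M M0 /(Lnorm_mu_ab_le f M0) fM]]; last first.
  by rewrite (le_lt_trans fM)// ltry.
have fE : (fine 'N[mu_ab]_+oo[EFin \o f])%:E = 'N[mu_ab]_+oo[EFin \o f]%E.
  by rewrite fineK// ge0_fin_numE// Lnorm_ge0.
exists (fine 'N[mu_ab]_+oo[EFin \o f]); first by rewrite fine_ge0// Lnorm_ge0.
by apply/Lnorm_mu_ab_le; rewrite ?fE// fine_ge0// Lnorm_ge0.
Qed.

Local Notation RR := (measurableTypeR R).

Section of_fun.
Variables (f : RR -> RR).
Hypothesis mf : measurable_fun [set: RR] f.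
Hypothesis bf : exists2 M : R, 0 <= M & \forall t \ae mu_ab, `|f t| <= M.

Let f_mfun : {mfun RR >-> RR} :=
  HB.pack f (isMeasurableFun.Build _ _ RR RR f mf).

Let f_class : {mfun_ mu_ab, RR >-> RR} := (\pi f_mfun)%qT.

Let f_classE : \forall t \ae mu_ab, f_class t = f t.
Proof.
have /eqmodP/asboolP := reprK f_class.
by apply: filterS => t; exact.
Qed.

Let f_class_finite : finite_norm mu_ab +oo%E f_class.
Proof.
have [M M0 fM] := bf; apply/finite_norm_mu_abP; exists M => //.
by apply: filterS2 fM f_classE => t + ->.
Qed.

Definition Linfty_of : Linfty := HB.pack_for (LspaceType mu_ab (leey 1%E))
  f_class (isFinLebesgue.Build _ _ _ _ _ (leey 1%E) f_class f_class_finite).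

Lemma Linfty_ofE : \forall t \ae mu_ab, Linfty_of t = f t.
Proof. exact: f_classE. Qed.

End of_fun.

Implicit Types X Y Z : Linfty.

Lemma Linfty_measurable X : measurable_fun [set: RR] (X : RR -> RR).
Proof.
exact: (@measurable_funPT _ _ _ _ (repr (X : {mfun_ mu_ab, RR >-> RR}))).
Qed.

Lemma Linfty_bounded X :
  exists2 M : R, 0 <= M & \forall t \ae mu_ab, `|X t| <= M.
Proof. by apply/finite_norm_mu_abP; exact: Lebesgue_finite. Qed.

Lemma Linfty_eqP X Y : X = Y <-> \forall t \ae mu_ab, X t = Y t.
Proof.
split=> [->|XY]; first by apply: filterS filterT.
have {XY} : (X : {mfun_ mu_ab, RR >-> RR}) = Y :> {mfun_ mu_ab, RR >-> RR}.
  rewrite -[LHS]reprK -[RHS]reprK; apply/eqmodP/asboolP.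
  by apply: filterS XY => t + _.
case: X Y => [X [[fX]]] [Y [[fY]]] /= XY.
by case: _ / XY fY => fY; rewrite (Prop_irrelevance fX fY).
Qed.

Let bounded0 : exists2 M : R, 0 <= M & \forall t \ae mu_ab, `|cst 0 t : R| <= M.
Proof.
by exists 0; rewrite ?lexx//; apply: filterS filterT => t _; rewrite normr0.
Qed.

Let boundedD X Y :
  exists2 M : R, 0 <= M & \forall t \ae mu_ab, `|(X \+ Y) t| <= M.
Proof.
have [M M0 XM] := Linfty_bounded X; have [N N0 YN] := Linfty_bounded Y.
exists (M + N); first exact: addr_ge0.
by apply: filterS2 XM YN => t Xt Yt; rewrite (le_trans (ler_normD _ _))// lerD.
Qed.

Let boundedZ k X :
  exists2 M : R, 0 <= M & \forall t \ae mu_ab, `|(cst k \* X) t| <= M.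
Proof.
have [M M0 XM] := Linfty_bounded X.
exists (`|k| * M); first exact: mulr_ge0.
by apply: filterS XM => t Xt; rewrite normrM ler_wpM2l.
Qed.

Definition Linfty_zero : Linfty :=
  Linfty_of (@measurable_cst _ _ RR RR setT 0) bounded0.

Definition Linfty_add X Y : Linfty := Linfty_of
  (measurable_funD (Linfty_measurable X) (Linfty_measurable Y)) (boundedD X Y).

Definition Linfty_scale (k : R) X : Linfty := Linfty_of
  (measurable_funM (@measurable_cst _ _ RR RR setT k) (Linfty_measurable X))
  (boundedZ k X).

Definition Linfty_opp X : Linfty := Linfty_scale (-1) X.

Let addE X Y : \forall t \ae mu_ab, Linfty_add X Y t = X t + Y t.
Proof. exact: Linfty_ofE. Qed.

Let scaleE (k : R) X : \forall t \ae mu_ab, Linfty_scale k X t = k * X t.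
Proof. exact: Linfty_ofE. Qed.

Let zeroE : \forall t \ae mu_ab, Linfty_zero t = 0.
Proof. exact: Linfty_ofE. Qed.

Let aeS4 (P1 P2 P3 P4 Q : R -> Prop) :
  (forall t, P1 t -> P2 t -> P3 t -> P4 t -> Q t) ->
  (\forall t \ae mu_ab, P1 t) -> (\forall t \ae mu_ab, P2 t) ->
  (\forall t \ae mu_ab, P3 t) -> (\forall t \ae mu_ab, P4 t) ->
  \forall t \ae mu_ab, Q t.
Proof.
move=> PQ aP1 aP2 aP3 aP4; near=> t.
apply: PQ; by [near: t|near: t|near: t|near: t].
Unshelve. all: by end_near. Qed.

Lemma Linfty_addrA : associative Linfty_add.
Proof.
move=> X Y Z; apply/Linfty_eqP.
apply: aeS4 (addE X (Linfty_add Y Z)) (addE Y Z)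
  (addE (Linfty_add X Y) Z) (addE X Y) => t.
by do 4 move=> ->; rewrite addrA.
Qed.

Lemma Linfty_addrC : commutative Linfty_add.
Proof.
move=> X Y; apply/Linfty_eqP.
by apply: filterS2 (addE X Y) (addE Y X) => t -> ->; rewrite addrC.
Qed.

Lemma Linfty_add0r : left_id Linfty_zero Linfty_add.
Proof.
move=> X; apply/Linfty_eqP.
by apply: filterS2 (addE Linfty_zero X) zeroE => t -> ->; rewrite add0r.
Qed.

Lemma Linfty_addNr : left_inverse Linfty_zero Linfty_opp Linfty_add.
Proof.
move=> X; apply/Linfty_eqP.
apply: filterS3 (addE (Linfty_opp X) X) (scaleE (-1) X) zeroE => t -> -> ->.
by rewrite mulN1r addNr.
Qed.

HB.instance Definition _ := gen_eqMixin Linfty.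
HB.instance Definition _ := gen_choiceMixin Linfty.
HB.instance Definition _ := GRing.isZmodule.Build Linfty
  Linfty_addrA Linfty_addrC Linfty_add0r Linfty_addNr.

Lemma LinftyD X Y : \forall t \ae mu_ab, (X + Y) t = X t + Y t.
Proof. exact: addE. Qed.

Lemma Linfty0 : \forall t \ae mu_ab, (0 : Linfty) t = 0.
Proof. exact: zeroE. Qed.

Lemma Linfty_scalerA (k l : R) X :
  Linfty_scale k (Linfty_scale l X) = Linfty_scale (k * l) X.
Proof.
apply/Linfty_eqP.
apply: filterS3 (scaleE k (Linfty_scale l X)) (scaleE l X) (scaleE (k * l) X).
by move=> t -> -> ->; rewrite mulrA.
Qed.

Lemma Linfty_scale1r : left_id 1 Linfty_scale.
Proof.
move=> X; apply/Linfty_eqP.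
by apply: filterS (scaleE 1 X) => t ->; rewrite mul1r.
Qed.

Lemma Linfty_scalerDr : right_distributive Linfty_scale +%R.
Proof.
move=> k X Y; apply/Linfty_eqP.
have H : \forall t \ae mu_ab,
    Linfty_scale k (X + Y) t = k * (X t + Y t).
  by apply: filterS2 (scaleE k (X + Y)) (LinftyD X Y) => t -> ->.
apply: aeS4 H (LinftyD (Linfty_scale k X) (Linfty_scale k Y))
  (scaleE k X) (scaleE k Y) => t.
by do 4 move=> ->; rewrite mulrDr.
Qed.

Lemma Linfty_scalerDl X : {morph Linfty_scale^~ X : k l / k + l >-> k + l}.
Proof.
move=> k l; apply/Linfty_eqP.
apply: aeS4 (scaleE (k + l) X)
  (LinftyD (Linfty_scale k X) (Linfty_scale l X))
  (scaleE k X) (scaleE l X) => t.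
by do 4 move=> ->; rewrite mulrDl.
Qed.

HB.instance Definition _ := GRing.Zmodule_isLmodule.Build R Linfty
  Linfty_scalerA Linfty_scale1r Linfty_scalerDr Linfty_scalerDl.

Lemma LinftyZ (k : R) X : \forall t \ae mu_ab, (k *: X) t = k * X t.
Proof. exact: scaleE. Qed.

Lemma LinftyN X : \forall t \ae mu_ab, (- X) t = - X t.
Proof.
by rewrite -scaleN1r; apply: filterS (LinftyZ (-1) X) => t ->; rewrite mulN1r.
Qed.

Definition Linfty_norm X : R := fine 'N[mu_ab]_+oo[EFin \o X]%E.

Lemma Linfty_norm_ge0 X : 0 <= Linfty_norm X.
Proof. by rewrite fine_ge0// Lnorm_ge0. Qed.

Lemma Linfty_norm_EFin X : (Linfty_norm X)%:E = 'N[mu_ab]_+oo[EFin \o X]%E.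
Proof.
by rewrite fineK// ge0_fin_numE ?Lnorm_ge0//; exact: Lebesgue_finite.
Qed.

Lemma Linfty_normP X (M : R) : 0 <= M ->
  Linfty_norm X <= M <-> \forall t \ae mu_ab, `|X t| <= M.
Proof. by move=> M0; rewrite -lee_fin Linfty_norm_EFin Lnorm_mu_ab_le. Qed.

Lemma Linfty_le_norm X : \forall t \ae mu_ab, `|X t| <= Linfty_norm X.
Proof. by apply/Linfty_normP; rewrite ?Linfty_norm_ge0. Qed.

Lemma Linfty_normD X Y : Linfty_norm (X + Y) <= Linfty_norm X + Linfty_norm Y.
Proof.
apply/Linfty_normP; first by rewrite addr_ge0 ?Linfty_norm_ge0.
apply: filterS3 (LinftyD X Y) (Linfty_le_norm X) (Linfty_le_norm Y).
move=> t -> Xt Yt.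
by rewrite (le_trans (ler_normD _ _))// lerD.
Qed.

Lemma Linfty_normZ (k : R) X : Linfty_norm (k *: X) = `|k| * Linfty_norm X.
Proof.
have le (l : R) Y : Linfty_norm (l *: Y) <= `|l| * Linfty_norm Y.
  apply/Linfty_normP; first by rewrite mulr_ge0 ?Linfty_norm_ge0.
  apply: filterS2 (LinftyZ l Y) (Linfty_le_norm Y) => t -> Yt.
  by rewrite normrM ler_wpM2l.
apply/eqP; rewrite eq_le le/=; have [->|k0] := eqVneq k 0.
  by rewrite normr0 mul0r Linfty_norm_ge0.
rewrite -ler_pdivlMl ?normr_gt0// -normfV.
by rewrite -[X in Linfty_norm X <= _](scalerK k0) le.
Qed.

Lemma Linfty_norm0_eq0 X : Linfty_norm X = 0 -> X = 0.
Proof.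
move=> X0; apply/Linfty_eqP.
apply: filterS2 (Linfty_le_norm X) Linfty0 => t Xt ->.
by apply/eqP; rewrite -normr_le0 -X0.
Qed.

HB.instance Definition _ := Lmodule_isNormed.Build R Linfty
  Linfty_normD Linfty_normZ Linfty_norm0_eq0.

Lemma Linfty_normE X : `|X| = fine 'N[mu_ab]_+oo[EFin \o X]%E.
Proof. by []. Qed.

End Linfty.

Section operators.
Context {R : realType} (a b : R).

Definition positive_op (T : Cab a b -> Linfty a b) : Prop :=
  forall x : Cab a b, (forall t, t \in `[a, b] -> 0 <= x t) ->
  \forall t \ae mu_ab a b, 0 <= T x t.

(* See positive_op_normE for the agreement with the operator norm. *)
Definition positive_op_norm (T : Cab a b -> Linfty a b) : R :=
  fine (ess_sup (mu_ab a b) (EFin \o T (Cab_one a b))).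

Lemma Cab_oneE t : t \in `[a, b] -> Cab_one a b t = 1.
Proof. by move=> tab; rewrite /= patchE mem_set. Qed.

Lemma Cab_norm_one_le : `|Cab_one a b| <= 1.
Proof.
by apply/Cab_normP => // t tab; rewrite Cab_oneE// normr1.
Qed.

Lemma positive_op_le_one (T : {linear Cab a b -> Linfty a b}) (x : Cab a b) :
  positive_op T -> `|x| <= 1 ->
  \forall t \ae mu_ab a b, `|T x t| <= T (Cab_one a b) t.
Proof.
move=> T0 /(Cab_normP x ler01) x1.
have le (y : Cab a b) : (forall t, t \in `[a, b] -> y t <= 1) ->
    \forall t \ae mu_ab a b, T y t <= T (Cab_one a b) t.
  move=> y1.
  have /T0 : forall t, t \in `[a, b] -> 0 <= (Cab_one a b - y) t.
    by move=> t tab; change (0 <= Cab_one a b t - y t);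
      rewrite Cab_oneE// subr_ge0 y1.
  rewrite linearB => T1y.
  apply: filterS3 T1y (LinftyD (T (Cab_one a b)) (- T y)) (LinftyN (T y)).
  by move=> t + E1 E2; rewrite E1 E2 subr_ge0.
have Tx : \forall t \ae mu_ab a b, T x t <= T (Cab_one a b) t.
  by apply: le => t /x1; exact: le_trans (ler_norm _).
have : \forall t \ae mu_ab a b, T (- x) t <= T (Cab_one a b) t.
  apply: le => t /x1; apply: le_trans.
  by change (- x t <= `|x t|); rewrite -normrN ler_norm.
rewrite linearN => TNx; apply: filterS3 Tx TNx (LinftyN (T x)) => t Txt + E.
by rewrite E => TNxt; rewrite ler_norml lerNl Txt TNxt.
Qed.

Lemma positive_op_normE (T : {linear Cab a b -> Linfty a b}) :
  a < b -> positive_op T ->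
  positive_op_norm T = sup [set `|T x| | x in [set x | `|x| <= 1]].
Proof.
move=> ab T0.
have mu0 : (0 < mu_ab a b setT)%E.
  rewrite /mu_ab /= /mrestr setTI lebesgue_measure_itv/= lte_fin ab.
  by rewrite -EFinB lte_fin subr_gt0.
have T1_ge0 : \forall t \ae mu_ab a b, 0 <= T (Cab_one a b) t.
  by apply: T0 => t tab; rewrite Cab_oneE.
have -> : positive_op_norm T = `|T (Cab_one a b)|.
  change (positive_op_norm T = Linfty_norm (T (Cab_one a b))).
  rewrite /positive_op_norm /Linfty_norm unlock /Lnorm mu0; congr fine.
  apply: (eq_ess_sup (mu := mu_ab a b)).
  by apply: filterS T1_ge0 => t t0 /=; rewrite ger0_norm.
have le1 x : `|x| <= 1 -> `|T x| <= `|T (Cab_one a b)|.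
  move=> x1; apply/Linfty_normP => //; have := positive_op_le_one T0 x1.
  apply: filterS2 (Linfty_le_norm (T (Cab_one a b))) => t + Tx.
  by apply: le_trans; rewrite (le_trans Tx)// ler_norm.
have one : [set `|T x| | x in [set x | `|x| <= 1]] `|T (Cab_one a b)|.
  by exists (Cab_one a b) => //; exact: Cab_norm_one_le.
apply/eqP; rewrite eq_le; apply/andP; split.
  by apply: ub_le_sup one; exists `|T (Cab_one a b)| => _ [x /le1 x1 <-].
apply: ge_sup; first by exists `|T (Cab_one a b)|.
by move=> _ [x /le1 x1 <-].
Qed.

End operators.

(* Degenerate intervals u i = v i are allowed; they contribute nothing. *)
Definition abs_continuous {R : realType} (a b : R) (f : R -> R) : Prop :=
  forall e : R, 0 < e -> exists2 d : R, 0 < d &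
  forall (n : nat) (u v : 'I_n -> R),
    (forall i, [/\ a <= u i, u i <= v i & v i <= b]) ->
    trivIset setT (fun i => `]u i, v i[%classic) ->
    \sum_(i < n) (v i - u i) < d ->
    \sum_(i < n) `|f (v i) - f (u i)| < e.

(* The filter of `|x| --> +oo on V. *)
Definition norm_infty {R : realType} (V : normedModType R) : set_system V :=
  filter_from [set: R] (fun M => [set x | M < `|x|]).
Arguments norm_infty {R} V.

(* Main.v *)
Require Import Defs.
From mathcomp Require Import all_boot all_order all_algebra.
From mathcomp Require Import all_classical all_reals all_analysis.
From mathcomp Require Import measurable_realfun finmap ring lra.

(** Put h = b - a, P = ||T+||, Q = ||T-||, A = h P, B = h Q.  A solution is a
    fixed point of the map G sending x to c + int_a^. (T+ x - T- x + F x).  It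
    is continuous, and it maps a ball to bounded functions with a common
    Lipschitz constant, which lie in a compact set of continuous functions
    ([compact_lipschitz_ball]).  By [schaefer_fixed_point], G has a fixed point
    as soon as, for some r, every solution of x = l G x with 0 <= l <= 1 and
    norm at most r has norm less than r.

    The a priori bound ([cauchy_map_apriori]).  Split x = l c + y with
    y(a) = 0, and let M = max y and - n = min y, attained at t1 and t2; both M
    and n are nonnegative.  Positivity gives - n P <= T+ y <= M P, and
    similarly for T-, so that y' lies between - (n P + M Q + e) and
    M P + n Q + e, where e = |c| (P + Q) + ||F x|| bounds the other terms; this
    interval contains 0, so the factor l <= 1 does not lead out of it.  If
    t1 <= t2 and t = (t1 - a) / h, integrating over [a, t1] and over [t1, t2]
    yields
      M <= t (M A + n B) + h e   and   M + n <= (1 - t) (n A + M B) + h e.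
    Eliminating M leaves n times the quadratic of the hypothesis, taken at t,
    bounded by a multiple of h e ([two_increments_bound]).  That quadratic is
    continuous and positive on [0, 1], hence bounded below by some d > 0, so n
    and then M are O(e).  If t2 < t1 the roles of M and n are exchanged.  In
    all, ||x|| <= C1 + C2 ||F x||, and sublinearity of F bounds ||x||.

    Schaefer's theorem comes from Schauder's by composing G with the radial
    retraction on a ball.  Schauder's theorem comes from Brouwer's: a finite net
    of the compact range turns approximate fixed points into fixed points of a
    map of R^n.  Brouwer's theorem is obtained from a discrete
    Poincare-Miranda theorem on the grid {0, ..., N}^n.  There, 0/1 functions
    g_1, ..., g_n are given, with g_i = 0 on the face z_i = 0 and g_i = 1 on
    the face z_i = N, and some unit cell on which no g_i is constant is wanted.
    The sum over all cells of the cubical cup product dg_1 ... dg_n with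
    coefficients in F_2 can be computed by Stokes' formula, because this product
    is the coboundary of g_1 dg_2 ... dg_n; by induction on n, it is 1.  Hence
    some cell has a nonzero product, and no g_i is constant on it. *)

Set Implicit Arguments.
Unset Strict Implicit.
Unset Printing Implicit Defensive.

Import Order.TTheory GRing.Theory Num.Theory.
Import numFieldNormedType.Exports.

Local Open Scope ring_scope.

(** * A discrete Poincare-Miranda theorem, modulo 2 *)

Lemma F2_addxx (x : 'F_2) : x + x = 0.
Proof. by apply: addrr_pchar2; rewrite pchar_Fp. Qed.

Section Grid.
Variable n : nat.
Local Notation pt := {ffun 'I_n -> nat}.
Implicit Types (z w : pt) (i j k : 'I_n) (J : {set 'I_n}) (f : pt -> 'F_2).

Definition upd z i (m : nat) : pt := [ffun j => if j == i then m else z j].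
Definition step z i : pt := upd z i (z i).+1.

Lemma updC z i j m l : i != j -> upd (upd z i m) j l = upd (upd z j l) i m.
Proof.
move=> ij; apply/ffunP => k; rewrite !ffunE.
by case: (eqVneq k j) => [->|//]; rewrite eq_sym (negbTE ij).
Qed.

Lemma upd_upd z i m l : upd (upd z i m) i l = upd z i l.
Proof. by apply/ffunP => k; rewrite !ffunE; case: eqVneq. Qed.

Lemma upd_same z i m : upd z i m i = m.
Proof. by rewrite ffunE eqxx. Qed.

Lemma upd_other z i j m : j != i -> upd z i m j = z j.
Proof. by rewrite ffunE => /negbTE ->. Qed.

Lemma step_upd z i m : step (upd z i m) i = upd z i m.+1.
Proof. by rewrite /step upd_same upd_upd. Qed.

Lemma stepC z i j : step (step z i) j = step (step z j) i.
Proof.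
have [->//|ij] := eqVneq i j.
by rewrite /step updC// !upd_other// eq_sym.
Qed.

(** The value on the cube with lowest vertex [z] and set of directions [J] of the
    cup product df_1 ... df_k of the coboundaries of the functions in [fs],
    expanded along its first factor.  It is a sum over the monotone paths along
    the edges of the cube; there are no signs modulo 2. *)
Fixpoint cup_diff (fs : seq (pt -> 'F_2)) J z : 'F_2 :=
  if fs is f :: fs' then
    \sum_(i in J) (f (step z i) + f z) * cup_diff fs' (J :\ i) (step z i)
  else 1.

Lemma sum_offdiag_sym J (H : 'I_n -> 'I_n -> 'F_2) :
  (forall i j, H i j = H j i) -> \sum_(i in J) \sum_(j in J :\ i) H i j = 0.
Proof.
move=> Hsym.
have split_lt i : \sum_(j in J :\ i) H i j =
    \sum_(j in J | (i < j)%N) H i j + \sum_(j in J | (j < i)%N) H i j.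
  rewrite (bigID (fun j : 'I_n => (i < j)%N)) /=.
  congr (_ + _); apply: eq_bigl => j;
    by rewrite !inE -val_eqE /=; case: ltngtP; rewrite ?andbT ?andbF.
under eq_bigr do rewrite split_lt.
rewrite big_split /= [X in _ + X](exchange_big_dep (mem J)) //=;
  last by move=> i j _ /andP[].
rewrite -big_split big1 //= => i iJ.
rewrite -[RHS](F2_addxx (\sum_(j in J | (i < j)%N) H i j)).
congr (_ + _); apply: eq_big => [j|j _]; last exact: Hsym.
by rewrite iJ.
Qed.

(** Leibniz rule: df_1 (df_2 ... df_k) = d(f_1 df_2 ... df_k) if
    df_2 ... df_k is closed. *)
Lemma cup_diff_cons_closed fs f J z :
  \sum_(i in J) (cup_diff fs (J :\ i) (step z i) + cup_diff fs (J :\ i) z) = 0 ->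
  cup_diff (f :: fs) J z =
  \sum_(i in J) (f (step z i) * cup_diff fs (J :\ i) (step z i)
                 + f z * cup_diff fs (J :\ i) z).
Proof.
move=> /(congr1 (fun x => cup_diff (f :: fs) J z + f z * x)).
rewrite mulr0 addr0 => <-; rewrite mulr_sumr /= -big_split /=.
apply: eq_bigr => i _; rewrite mulrDl mulrDr addrACA -addrA; congr (_ + _).
by rewrite addrA F2_addxx add0r.
Qed.

(** A product of coboundaries is itself a coboundary, and d d = 0: the terms
    of d d are indexed by pairs of distinct directions, are symmetric in them, and
    so cancel in pairs modulo 2. *)
Lemma cup_diff_closed fs J z :
  \sum_(i in J) (cup_diff fs (J :\ i) (step z i) + cup_diff fs (J :\ i) z) = 0.
Proof.
elim: fs J z => [|f fs IH] J z; first by rewrite big1// => i _; exact: F2_addxx.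
pose h i j w := f w * cup_diff fs (J :\ i :\ j) w.
pose H i j := h i j (step (step z i) j) + h i j (step z i)
              + (h i j (step z j) + h i j z).
rewrite -[RHS](@sum_offdiag_sym J H); last first.
  by move=> i j; rewrite /H /h stepC !finset.setDDl finset.setUC addrACA.
by apply: eq_bigr => i _; rewrite !cup_diff_cons_closed// -big_split.
Qed.

Lemma cup_diff_cons fs f J z :
  cup_diff (f :: fs) J z =
  \sum_(i in J) (f (step z i) * cup_diff fs (J :\ i) (step z i)
                 + f z * cup_diff fs (J :\ i) z).
Proof. exact/cup_diff_cons_closed/cup_diff_closed. Qed.

(** Only the values of the functions on the vertices of the cube enter the
    product, and a function that is constant there has a zero factor. *)
Lemma cup_diff_neq0 (g : 'I_n -> pt -> 'F_2) s J z i :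
  cup_diff (map g s) J z != 0 -> i \in s -> exists w w',
    [/\ g i w != g i w', forall k, (z k <= w k <= z k + (k \in J))%N &
        forall k, (z k <= w' k <= z k + (k \in J))%N].
Proof.
elim: s J z => [//|j s IH] J z /= nz.
have [k kJ] : exists2 k, k \in J &
    (g j (step z k) + g j z) * cup_diff (map g s) (J :\ k) (step z k) != 0.
  apply/exists_inP; apply: contraNT nz; rewrite negb_exists_in => /forall_inP h.
  by rewrite big1// => k kJ; apply/eqP; move: (h k kJ); rewrite negbK.
rewrite mulf_eq0 negb_or => /andP[d1 d2].
have cellk l : (z l <= step z k l <= z l + (l \in J))%N.
  rewrite ffunE; case: eqVneq => [->|_];
    by rewrite ?kJ ?addn1 ?leqnSn ?leqnn ?leq_addr.
rewrite inE => /orP[/eqP ->|is_].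
  exists (step z k), z; split => //; last by move=> l; rewrite leqnn leq_addr.
  by apply: contraNneq d1 => ->; rewrite F2_addxx.
have [w [w' [gw cw cw']]] := IH _ _ d2 is_.
have sub v : (forall l, (step z k l <= v l <= step z k l + (l \in J :\ k))%N) ->
    forall l, (z l <= v l <= z l + (l \in J))%N.
  move=> cv l; have := cv l; have /andP[zl _] := cellk l.
  move=> /andP[l1 l2]; rewrite (leq_trans zl l1) /=.
  apply: leq_trans l2 _; rewrite ffunE !inE; case: eqVneq => [->|//].
  by rewrite kJ addn0 addn1.
by exists w, w'; split => //; exact: sub.
Qed.

Variable N : nat.

(** The directions in [s] are summed over one at a time, so that the sum along
    any chosen direction can be moved to the front ([boxsum_rem]) and
    telescoped ([boxsum_diff]). *)
Fixpoint boxsum (s : seq 'I_n) (phi : pt -> 'F_2) z : 'F_2 :=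
  if s is i :: s' then \sum_(k < N) boxsum s' phi (upd z i k) else phi z.

Lemma eq_boxsum s phi psi z : phi =1 psi -> boxsum s phi z = boxsum s psi z.
Proof.
move=> e; elim: s z => [|i s IH] z /=; first exact: e.
by apply: eq_bigr => k _.
Qed.

Lemma boxsum0 s z : boxsum s (fun=> 0) z = 0.
Proof. by elim: s z => //= i s IH z; rewrite big1. Qed.

Lemma boxsum_sum (I : Type) (r : seq I) (P : pred I) s
    (phi : I -> pt -> 'F_2) z :
  boxsum s (fun w => \sum_(x <- r | P x) phi x w) z =
  \sum_(x <- r | P x) boxsum s (phi x) z.
Proof.
elim: s z => //= i s IH z; rewrite exchange_big /=.
by apply: eq_bigr => k _.
Qed.

Lemma boxsum_upd s phi z i m : i \notin s ->
  boxsum s phi (upd z i m) = boxsum s (fun w => phi (upd w i m)) z.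
Proof.
elim: s z => //= j s IH z; rewrite inE negb_or => /andP[ij is_].
by apply: eq_bigr => k _; rewrite updC// IH.
Qed.

Lemma boxsum_rem s phi z i : uniq s -> i \in s ->
  boxsum s phi z = boxsum (rem i s) (fun w => \sum_(k < N) phi (upd w i k)) z.
Proof.
elim: s z => //= j s IH z /andP[js us]; rewrite inE eq_sym.
case: eqVneq => [<- _|ij /= is_].
  by rewrite boxsum_sum; apply: eq_bigr => k _; rewrite boxsum_upd.
by apply: eq_bigr => k _; rewrite IH.
Qed.

Lemma boxsum_diff s phi z i : uniq s -> i \in s ->
  boxsum s (fun w => phi (step w i) + phi w) z =
  boxsum (rem i s) (fun w => phi (upd w i N) + phi (upd w i 0%N)) z.
Proof.
move=> us is_; rewrite (boxsum_rem _ _ us is_); apply: eq_boxsum => w.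
under eq_bigr do rewrite step_upd.
elim: N => [|m IH]; first by rewrite big_ord0 F2_addxx.
by rewrite big_ord_recr /= IH addrC -addrA [X in _ + X]addrA F2_addxx add0r.
Qed.

Lemma boxsum_neq0 s phi z : boxsum s phi z != 0 ->
  exists2 w, phi w != 0 & forall i, i \in s -> uniq s -> (w i < N)%N.
Proof.
(* The coordinates outside [s] are kept track of for the induction. *)
suff gen z0 : boxsum s phi z0 != 0 -> exists w, [/\ phi w != 0,
    forall i, i \notin s -> w i = z0 i &
    uniq s -> forall i, i \in s -> (w i < N)%N].
  by move=> /gen[w [w0 _ ws]]; exists w => // i is_ us; exact: ws.
elim: s z0 => [|i s IH] z0 /= nz; first by exists z0.
have [k kP] : exists k : 'I_N, boxsum s phi (upd z0 i k) != 0.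
  apply/existsP; apply: contraNT nz; rewrite negb_exists => /forallP h.
  by rewrite big1// => k _; apply/eqP; move: (h k); rewrite negbK.
have [w [w0 wout win]] := IH _ kP; exists w; split => //.
- by move=> j; rewrite inE negb_or => /andP[ji js]; rewrite wout// upd_other.
- move=> /andP[is_ us] j; rewrite inE => /orP[/eqP ->|]; last exact: win.
  by rewrite wout// upd_same.
Qed.

Variable g : 'I_n -> pt -> 'F_2.
Hypothesis g0 : forall i z, z i = 0%N -> g i z = 0.
Hypothesis gN : forall i z, z i = N -> g i z = 1.

(** On a face orthogonal to [j] the function [g j] is constant, so its
    differences in the directions of the face vanish. *)
Lemma cup_diff_face s J z j : j \in s -> j \notin J -> z j = 0%N \/ z j = N ->
  cup_diff (map g s) J z = 0.
Proof.
elim: s J z => //= i s IH J z js jJ zj; rewrite big1// => k kJ.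
have jk : j != k by apply: contraNneq jJ => ->.
have sj : step z k j = z j by rewrite upd_other.
move: js; rewrite inE => /orP[/eqP <-|js]; last first.
  by rewrite IH ?mulr0 ?sj// !inE negb_and jJ orbT.
have -> : g j (step z k) = g j z.
  by case: zj => zj; [rewrite !g0 ?sj|rewrite !gN ?sj].
by rewrite F2_addxx mul0r.
Qed.

(** Stokes' formula turns the sum into face terms.  Those of the faces
    orthogonal to the direction of a later factor vanish by [cup_diff_face], that
    of the face where [g i] is 0 vanishes too, and that of the face where
    [g i] is 1 is the same sum in one dimension less. *)
Lemma boxsum_cup_diff s z : uniq s ->
  boxsum s (cup_diff (map g s) [set i in s]) z = 1.
Proof.
elim: s z => [//|i s IH] z us.
rewrite map_cons (eq_boxsum _ _ (cup_diff_cons _ _ _)) boxsum_sum /=.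
set J := [set j in _]; have iJ : i \in J by rewrite inE mem_head.
rewrite (bigD1 i)//= [X in _ + X]big1 ?addr0; last first.
  move=> j /andP[jJ ji]; pose h w := g i w * cup_diff (map g s) (J :\ j) w.
  have js : j \in i :: s by rewrite inE in jJ.
  have jin : j \in s by move: js; rewrite inE (negbTE ji).
  rewrite -[LHS]/(boxsum (i :: s) (fun w => h (step w j) + h w) z) boxsum_diff//.
  rewrite -[RHS](boxsum0 (rem j (i :: s)) z); apply: eq_boxsum => w.
  rewrite /h !(@cup_diff_face s _ _ j) ?mulr0 ?addr0// ?inE ?eqxx// upd_same; tauto.
move: (us) => /= /andP[is_ us'].
have -> : J :\ i = [set j in s].
  apply/setP => j; rewrite !inE; case: eqVneq => [->|//].
  by rewrite (negbTE is_).
pose h w := g i w * cup_diff (map g s) [set j in s] w.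
rewrite -[LHS]/(boxsum (i :: s) (fun w => h (step w i) + h w) z).
rewrite boxsum_diff ?mem_head//= eqxx.
rewrite -(IH (upd z i N) us') boxsum_upd//; apply: eq_boxsum => w.
by rewrite /h (gN (upd_same w i N)) (g0 (upd_same w i 0)) mul1r mul0r addr0.
Qed.

Lemma discrete_poincare_miranda : exists z : pt,
  (forall i, (z i < N)%N) /\
  forall i, exists w w', [/\ g i w != g i w',
    forall k, (z k <= w k <= (z k).+1)%N &
    forall k, (z k <= w' k <= (z k).+1)%N].
Proof.
have /boxsum_neq0[z dz zN] : boxsum (enum 'I_n)
    (cup_diff (map g (enum 'I_n)) [set i in enum 'I_n]) [ffun=> 0%N] != 0.
  by rewrite boxsum_cup_diff ?enum_uniq// oner_neq0.
exists z; split=> [i|i]; first by apply: zN; rewrite ?mem_enum ?enum_uniq.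
have [|w [w' [gw cw cw']]] := cup_diff_neq0 (i := i) dz; first by rewrite mem_enum.
have sub v : (forall k, (z k <= v k <= z k + (k \in [set i in enum 'I_n]))%N) ->
    forall k, (z k <= v k <= (z k).+1)%N.
  by move=> cv k; have := cv k; rewrite inE mem_enum addn1.
by exists w, w'; split => //; exact: sub.
Qed.

End Grid.

(** * Brouwer's fixed point theorem *)

Local Open Scope classical_set_scope.
Local Open Scope ring_scope.

Lemma compact_seq_cluster {R : realType} {V : normedModType R} (K : set V)
    (v : nat -> V) : compact K -> (forall k, K (v k)) ->
  exists2 p, K p & forall (e : R) (m : nat), 0 < e ->
    exists2 k, (m <= k)%N & `|p - v k| < e.
Proof.
move=> cK vK; have [|p [Kp clp]] := cK (v @ \oo) _.
  by exists 0%N => // k _; exact: vK.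
exists p => // e m e0.
have [||_ [[k mk <-] /=]] := clp (v @` [set k | (m <= k)%N]) (ball p e).
- by exists m => // k mk; exists k.
- exact: nbhsx_ballx.
by rewrite -ball_normE /= => pk; exists k.
Qed.

Section Brouwer.
Context {R : realType} (n : nat).
Local Notation pt := {ffun 'I_n -> nat}.

Definition grid_pt (N : nat) (z : pt) : 'rV[R]_n := \row_i ((z i)%:R / N.+1%:R).

Lemma grid_pt_cell N (z w : pt) : (forall k, (z k <= w k <= (z k).+1)%N) ->
  `|grid_pt N z - grid_pt N w| <= N.+1%:R^-1.
Proof.
move=> zw; rewrite -[leLHS]/(mx_norm _) mx_normrE; apply/bigmax_leP.
split; first by rewrite invr_ge0.
move=> [i j] _ /=; rewrite !mxE -mulrBl normrM [X in _ * X]ger0_norm ?invr_ge0//.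
rewrite -[leRHS]mul1r ler_wpM2r ?invr_ge0//.
have /andP[z1 z2] := zw j; rewrite distrC -natrB// ger0_norm//.
by rewrite lern1 leq_subLR addn1.
Qed.

Variable Phi : 'I_n -> 'rV[R]_n -> R.
Hypothesis Phi_cont : forall i, continuous (Phi i).
Hypothesis Phi_itv : forall i u, 0 <= Phi i u <= 1.

(** Apply the discrete theorem to the indicator of [Phi i u <= u i]: it may be
    set to 0 on the face u_i = 0, where [u i <= Phi i u] holds as well, and it is 1
    on the face u_i = 1 since [Phi i <= 1]. *)
Lemma brouwer_grid N : exists u : 'rV[R]_n,
  (forall i, 0 <= u 0 i <= 1) /\
  forall i, exists w w' : 'rV[R]_n,
    [/\ `|u - w| <= N.+1%:R^-1, `|u - w'| <= N.+1%:R^-1,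
        Phi i w <= w 0 i & w' 0 i <= Phi i w'].
Proof.
pose above (i : 'I_n) (z : pt) :=
  (0 < z i)%N && (Phi i (grid_pt N z) <= grid_pt N z 0 i).
have [i z z0|i z zN|z [zlt zcell]] := @discrete_poincare_miranda n N.+1
    (fun i z => if above i z then 1 else 0).
- by rewrite /above z0.
- suff -> : above i z by [].
  rewrite /above zN /= mxE zN divff ?pnatr_eq0//.
  by have /andP[] := Phi_itv i (grid_pt N z).
exists (grid_pt N z); split=> [i|i].
  rewrite mxE divr_ge0//= ler_pdivrMr ?ltr0n// mul1r ler_nat.
  exact: ltnW (zlt i).
have cross w w' : above i w -> ~~ above i w' ->
    (forall k, (z k <= w k <= (z k).+1)%N) ->
    (forall k, (z k <= w' k <= (z k).+1)%N) -> exists w w' : 'rV[R]_n,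
    [/\ `|grid_pt N z - w| <= N.+1%:R^-1, `|grid_pt N z - w'| <= N.+1%:R^-1,
        Phi i w <= w 0 i & w' 0 i <= Phi i w'].
  move=> /andP[_ aw] aw' cw cw'; exists (grid_pt N w), (grid_pt N w').
  split => //; [exact: grid_pt_cell|exact: grid_pt_cell|].
  move: aw'; rewrite negb_and -ltNge => /orP[|/ltW//].
  rewrite -eqn0Ngt => /eqP w0; rewrite [leLHS]mxE w0 mul0r.
  by have /andP[] := Phi_itv i (grid_pt N w').
have [w [w' [gw cw cw']]] := zcell i; move: gw.
case: ifPn => aw; case: ifPn => aw'; rewrite ?eqxx// => _.
  exact: cross cw cw'.
exact: cross cw' cw.
Qed.

(** On finer and finer grids, a cluster point of the cells of [brouwer_grid] is a
    limit both of points where [Phi i u <= u i] and of points where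
    [u i <= Phi i u].  Taking a map of the whole space with values in the unit
    cube avoids continuity on a subset; precomposing with the coordinatewise
    projection on the cube gives the usual form. *)
Theorem brouwer_fixed_point : exists u, forall i, Phi i u = u 0 i.
Proof.
have /choice[v vP] := brouwer_grid.
have cK : compact [set u : 'rV[R]_n | forall i, `[0, 1]%classic (u ord0 i)].
  apply: (@rV_compact R n (fun=> `[0, 1]%classic)) => i.
  exact: segment_compact.
have [k i|u _ uv] := compact_seq_cluster (v := v) cK.
  by rewrite /= in_itv /=; exact: (vP k).1.
have arb (e : R) : 0 < e -> exists k, `|u - v k| < e / 2 /\ k.+1%:R^-1 < e / 2.
  move=> e0; have e2 : 0 < e / 2 by rewrite divr_gt0.
  have [m mP] : exists m, m.+1%:R^-1 < e / 2.
    have [m _ /(_ _ (leqnn _))] := near_infty_natSinv_lt (PosNum e2).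
    by exists m.
  have [k mk ku] := uv _ m e2; exists k; split=> //.
  by apply: le_lt_trans mP; rewrite lef_pV2 ?posrE ?ltr0n// ler_nat.
exists u => i; apply/eqP.
have coordc : continuous (fun w : 'rV[R]_n => w 0 i).
  exact: coord_continuous.
have ci (w : 'rV[R]_n) : {for w, continuous (fun w => Phi i w - w 0 i)}.
  by apply: (@continuousB _ R^o); [exact: Phi_cont|exact: coordc].
rewrite -subr_eq0 eq_le; apply/andP; split; rewrite leNgt; apply/negP => hlt.
- have /nbhs_ballP[e /= e0 eP] : \forall w \near u, 0 < Phi i w - w 0 i.
    exact: (cvgr_gt (Phi i u - u 0 i) (ci u)).
  have [k [uk ke]] := arb e e0; have [w [_ [vw _ Pw _]]] := (vP k).2 i.
  have /eP /= : ball u e w.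
    rewrite -ball_normE /= (splitr e) -(subrKA (v k)).
    by rewrite (le_lt_trans (ler_normD _ _))// ltrD// (le_lt_trans vw).
  by rewrite subr_gt0 ltNge Pw.
- have /nbhs_ballP[e /= e0 eP] : \forall w \near u, Phi i w - w 0 i < 0.
    exact: (cvgr_lt (Phi i u - u 0 i) (ci u)).
  have [k [uk ke]] := arb e e0; have [_ [w [_ vw _ Pw]]] := (vP k).2 i.
  have /eP /= : ball u e w.
    rewrite -ball_normE /= (splitr e) -(subrKA (v k)).
    by rewrite (le_lt_trans (ler_normD _ _))// ltrD// (le_lt_trans vw).
  by rewrite subr_lt0 ltNge Pw.
Qed.

End Brouwer.

(** * The fixed point theorems of Schauder and Schaefer *)

Section Schauder.
Context {R : realType} {V : normedModType R}.
Implicit Types (K : set V) (e : R).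

Lemma compact_finite_net K e : compact K -> 0 < e ->
  exists2 s : seq V, {in s, forall p, K p} &
    forall y, K y -> exists2 p, p \in s & `|y - p| < e.
Proof.
move=> + e0; rewrite compact_cover.
move=> /(_ V K (fun p => ball p e)) [p _|y Ky|D DK KD].
- exact: ball_open.
- by exists y => //; exact: ballxx.
- exists (enum_fset D) => [p /DK|y /KD[p pD]]; first exact: set_mem.
  by rewrite -ball_normE /= => py; exists p => //; rewrite distrC.
Qed.

Variables (H : V -> V) (K : set V).
Hypotheses (H_cont : continuous H) (cK : compact K) (HK : forall x, K (H x)).

(** With a finite [e]-net y_1, ..., y_n of [K] and weights w_j(x) that vanish
    unless x is within [e] of y_j, every x in [K] is within [e] of the weighted
    mean of the y_j.  Brouwer's theorem for the map
    u |-> (normalized weights of H (sum_j u_j y_j)) makes x = sum_j u_j y_j equal to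
    the weighted mean at H x. *)
Lemma schauder_approx e : 0 < e -> exists x, `|x - H x| <= e.
Proof.
move=> e0; have [s _ sP] := compact_finite_net cK e0.
pose n := size s; pose y (j : 'I_n) := s`_j.
pose comb (u : 'rV[R]_n) := \sum_(j < n) u 0 j *: y j.
pose weight j (x : V) := Order.max 0 (e - `|x - y j|).
pose total x := \sum_(j < n) weight j x.
have weight_ge0 j x : 0 <= weight j x by rewrite le_max lexx.
have total_gt0 x : K x -> 0 < total x.
  move=> /sP[p ps xp].
  have ip : (index p s < n)%N by rewrite index_mem.
  apply: (@lt_le_trans _ _ (weight (Ordinal ip) x)).
    by rewrite lt_max subr_gt0 /y /= nth_index// xp orbT.
  by rewrite /total (bigD1 (Ordinal ip))//= lerDl sumr_ge0.
have weight_cont j : continuous (weight j).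
  move=> x; apply: (@continuous_max _ _ (fun=> 0) (fun x => e - `|x - y j|)).
    exact: cst_continuous.
  apply: (@continuousB _ R^o); first exact: cst_continuous.
  apply: (@continuous_comp _ _ _ (fun x => x - y j) Num.norm);
    last exact: norm_continuous.
  by apply: continuousB; [exact: cvg_id|exact: cst_continuous].
have total_cont : continuous total.
  apply: (@continuous_big R^o); first exact: add_continuous.
  by move=> i _; exact: weight_cont.
have comb_cont : continuous comb.
  apply: continuous_big; first exact: add_continuous.
  move=> j _ u; apply: (@continuousZr_tmp R V _ (fun u : 'rV[R]_n => u 0 j)).
  exact: coord_continuous.
have H_comb : continuous (H \o comb).
  by move=> u; apply: continuous_comp; [exact: comb_cont|exact: H_cont].
have [|j x|u uP] := @brouwer_fixed_point R n
    (fun j u => weight j (H (comb u)) / total (H (comb u))).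
- move=> j u.
  apply: (@continuousM R _ (weight j \o (H \o comb))
    (fun u => (total (H (comb u)))^-1)).
    apply: (@continuous_comp _ _ _ (H \o comb) (weight j)).
      exact: H_comb.
    exact: weight_cont.
  apply: continuousV; first by rewrite gt_eqF// total_gt0.
  apply: (@continuous_comp _ _ _ (H \o comb) total).
    exact: H_comb.
  exact: total_cont.
- have t0 := total_gt0 _ (HK (comb x)).
  rewrite divr_ge0 ?(ltW t0)//= ler_pdivrMr// mul1r.
  by rewrite /total (bigD1 j)//= lerDl sumr_ge0.
exists (comb u); set z := H (comb u).
have tz : 0 < total z by exact/total_gt0/HK.
have sumu : \sum_(j < n) u 0 j = 1.
  under eq_bigr do rewrite -uP.
  by rewrite -mulr_suml divff// gt_eqF.
rewrite -[X in _ - X]scale1r -sumu scaler_suml -sumrB.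
rewrite (le_trans (ler_norm_sum _ _ _))// -[leRHS]mul1r -sumu mulr_suml.
apply: ler_sum => j _; rewrite -scalerBr normrZ.
have u0 : 0 <= u 0 j by rewrite -uP divr_ge0// ltW.
rewrite ger0_norm//; have [->|uj] := eqVneq (u 0 j) 0; first by rewrite !mul0r.
rewrite ler_wpM2l// distrC ltW// -subr_gt0.
have : weight j z != 0 by apply: contraNneq uj => wj; rewrite -uP -/z wj mul0r.
by rewrite /weight; case: ltP => // _; rewrite eqxx.
Qed.

Theorem schauder_fixed_point : exists x, H x = x.
Proof.
have /choice[x xP] k : exists x, `|x - H x| <= k.+1%:R^-1.
  by apply: schauder_approx; rewrite invr_gt0.
have [k|p _ pP] := compact_seq_cluster (v := H \o x) cK; first exact: HK.
exists p; apply/eqP; rewrite -subr_eq0 -normr_le0; apply/ler_addgt0Pr => e e0.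
rewrite add0r; have e2 : 0 < e / 2 by rewrite divr_gt0.
have Hp : \forall x \near p, `|H p - H x| < e / 2.
  have /cvgrPdist_lt := @H_cont p; exact.
have /nbhs_ballP[d /= d0 dP] := Hp.
pose r := Order.min d e / 2.
have r0 : 0 < r by rewrite divr_gt0// lt_min d0.
have [m mP] : exists m, m.+1%:R^-1 < r.
  by have [m _ /(_ _ (leqnn _))] := near_infty_natSinv_lt (PosNum r0); exists m.
have [k mk /= pk] := pP r m r0.
have xk : `|H (x k) - x k| < r.
  rewrite distrC (le_lt_trans (xP k))//; apply: le_lt_trans mP.
  by rewrite lef_pV2 ?posrE ?ltr0n// ler_nat.
have /dP /= Hk : ball p d (x k).
  rewrite -ball_normE /= -(subrKA (H (x k))).
  rewrite (le_lt_trans (ler_normD _ _))// (lt_le_trans (ltrD pk xk))//.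
  by rewrite -splitr ge_min lexx.
rewrite -(subrKA (H (x k))) (le_trans (ler_normD _ _))// [leRHS]splitr.
rewrite lerD ?(ltW Hk)// distrC (le_trans (ltW pk))//.
by rewrite ler_wpM2r// ge_min lexx orbT.
Qed.

End Schauder.

(** Let z be a fixed point of G composed with the radial retraction on the ball
    of radius [r], and let x be the retraction of z.  Then x = l G x with
    l = r / max(r, ||z||), so ||x|| < r by assumption, which forces z = x. *)
Theorem schaefer_fixed_point {R : realType} {V : normedModType R} (G : V -> V)
    (r : R) (K : set V) : 0 < r -> continuous G -> compact K ->
  (forall x, `|x| <= r -> K (G x)) ->
  (forall x (l : R), `|x| <= r -> 0 <= l <= 1 -> x = l *: G x -> `|x| < r) ->
  exists x, G x = x.
Proof.
move=> r0 G_cont cK GK apriori.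
pose l (x : V) := r / Order.max r `|x|.
have max_gt0 (x : V) : 0 < Order.max r `|x| by rewrite lt_max r0.
have l01 x : 0 <= l x <= 1.
  rewrite divr_ge0 ?(ltW r0) ?(ltW (max_gt0 x))//= ler_pdivrMr// mul1r.
  by rewrite le_max lexx.
have l_cont : continuous l.
  move=> x; apply: (@continuousM R _ (fun=> r)
    (fun x : V => (Order.max r `|x|)^-1)).
    exact: cst_continuous.
  apply: continuousV; first by rewrite gt_eqF.
  apply: (@continuous_max _ _ (fun=> r) (fun x : V => `|x|)).
    exact: cst_continuous.
  exact: norm_continuous.
pose P x := l x *: x.
have P_le x : `|P x| <= r.
  have /andP[lx _] := l01 x.
  rewrite normrZ ger0_norm// /l mulrAC ler_pdivrMr// ler_wpM2l ?(ltW r0)//.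
  by rewrite le_max lexx orbT.
have P_cont : continuous P.
  by move=> x; apply: continuousZ; [exact: l_cont|exact: cvg_id].
have [|x|z zP] := @schauder_fixed_point R V (G \o P) K _ cK.
- by move=> x; apply: continuous_comp; [exact: P_cont|exact: G_cont].
- exact/GK/P_le.
have := apriori (P z) (l z) (P_le z) (l01 z).
rewrite {1}/P -[X in _ *: X = _]zP => /(_ erefl).
have [zr _|rz] := ltP `|z| r.
  exists z; rewrite -[RHS]zP /= /P /l max_l ?(ltW zr)// divff ?gt_eqF//.
  by rewrite scale1r.
rewrite /P /l max_r// normrZ normrM normrV ?unitfE ?gt_eqF//; last first.
  exact: lt_le_trans rz.
rewrite normr_id divfK ?gtr0_norm ?ltxx// gt_eqF//.
exact: lt_le_trans rz.
Qed.

(** * Compact sets of Lipschitz functions *)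

Lemma ultra_cvg_compact {R : realType} {T : Type} (F : set_system T)
    (f : T -> R) (A : set R) : UltraFilter F -> compact A -> F (f @^-1` A) ->
  exists2 p, A p & f x @[x --> F] --> p.
Proof.
move=> FU cA FA; have [p [Ap clp]] := cA (f @ F) _ FA; exists p => // U Up.
have [//|FnU] := in_ultra_setVsetC (f @^-1` U) FU.
by have [q [/= nUq /nUq]] := clp (~` U) U FnU Up.
Qed.

Section LipschitzCab.
Context {R : realType} (a b : R).

Definition lipschitz_itv (L : R) (f : R -> R) :=
  {in `[a, b] &, forall s t, `|f s - f t| <= L * `|s - t|}.

Lemma lipschitz_itv_within (L : R) (f : R -> R) : 0 <= L ->
  lipschitz_itv L f -> {within `[a, b], continuous f}.
Proof.
move=> L0 fL; apply/subspace_continuousP => t tab; apply/cvgrPdist_lt => e e0.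
have d0 : 0 < e / (L + 1) by rewrite divr_gt0// ltr_wpDl.
apply/nbhs_ballP; exists (e / (L + 1)) => //= s ts sab.
rewrite (le_lt_trans (fL _ _ tab sab))//.
move: ts; rewrite /ball /= ltr_pdivlMr ?ltr_wpDl// mulrC; apply: le_lt_trans.
by rewrite ler_wpM2r// lerDl.
Qed.

Lemma lipschitz_itv_Cab (L : R) (f : R -> R) : 0 <= L -> lipschitz_itv L f ->
  f \_ `[a, b] \in Cab_pred a b.
Proof.
move=> L0 fL; apply/Cab_predP; split=> [|t tab]; last first.
  by rewrite patchE ifF//; apply/negbTE; rewrite notin_setE /=; exact/negP.
apply: (@subspace_eq_continuous _ _ _ (f : subspace `[a, b]%classic -> R)).
  by move=> t tab; rewrite /from_subspace patchE tab.
exact: lipschitz_itv_within fL.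
Qed.

Definition lipschitz_ball (M L : R) : set (Cab a b) :=
  [set x : Cab a b | `|x| <= M /\ lipschitz_itv L x].

(** Along an ultrafilter the functions converge pointwise, by compactness of a
    segment.  The limit is Lipschitz with the same constant, and convergence on a
    finite net of [[a, b]] is uniform convergence up to the common modulus of
    continuity. *)
Lemma compact_lipschitz_ball (M L : R) : 0 <= M -> 0 <= L ->
  compact (lipschitz_ball M L).
Proof.
move=> M0 L0; rewrite compact_ultra => F FU FK.
have FK1 : F [set x : Cab a b | `|x| <= M /\ lipschitz_itv L x] by [].
have /choice[y yP] (t : R) :
    exists p : R, ((x : Cab a b) t : R) @[x --> F] --> p.
  have [|p _ xp] := @ultra_cvg_compact R _ F (fun x : Cab a b => x t)
    `[- M, M]%classic FU (@segment_compact _ _ _); last by exists p.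
  apply: filterS FK1 => x [xM _].
  by rewrite /= in_itv /= -ler_norml (le_trans (Cab_le_norm x t)).
have yL : lipschitz_itv L y.
  move=> s t sab tab.
  have cv : `|(x : Cab a b) s - x t| @[x --> F] --> `|y s - y t|.
    by apply: cvg_norm; apply: cvgB; exact: yP.
  rewrite leNgt; apply/negP => /(cvgr_gt _ cv) gt.
  have [x [[_ xL]]] := filter_ex (filterI FK1 gt).
  by rewrite ltNge xL.
pose z := MkCab (lipschitz_itv_Cab L0 yL).
have zE t : t \in `[a, b] -> z t = y t by move=> tab; rewrite /= patchE mem_set.
have zL : lipschitz_itv L z by move=> s t sab tab; rewrite !zE// yL.
have xz : F --> z.
  (* [L * d <= e / 4] leaves a quarter of [e] to each of the two moves to the
     net, and one to the distance on the net. *)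
  apply/cvgrPdist_le => e e0; pose d := e / (4 * (L + 1)).
  have d0 : 0 < d by rewrite divr_gt0// mulr_gt0// ltr_wpDl.
  have Ld : L * d <= e / 4.
    rewrite /d mulrA ler_pdivrMr ?mulr_gt0 ?ltr_wpDl//.
    by rewrite (_ : _ * (4 * _) = L * e + e) ?lerDl ?ltW//; field.
  have [s sab snet] := @compact_finite_net R R^o `[a, b]%classic d
    (@segment_compact _ a b) d0.
  have nears : F [set x : Cab a b | {in s, forall p, `|z p - x p| <= e / 4}].
    elim: s sab {snet} => [_|p s IH sab]; first by apply: filterS filterT.
    have pab : p \in `[a, b] by apply: sab; rewrite mem_head.
    have /cvgrPdist_le/(_ (e / 4)) := yP p.
    rewrite divr_gt0// => /(_ erefl) np.
    have ns := IH (fun q qs => sab q (@mem_behead _ (p :: s) q qs)).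
    apply: filterS2 np ns => x xp xs q; rewrite inE => /orP[/eqP ->|/xs//].
    by rewrite zE.
  apply: filterS2 FK1 nears => x [_ xL] xs.
  apply/Cab_normP; first exact: ltW.
  move=> t tab; change (`|z t - x t| <= e).
  have [p ps /ltW tp] := snet t tab.
  have pab : p \in `[a, b] by exact: sab.
  have zt : `|z t - z p| <= e / 4.
    by rewrite (le_trans (zL _ _ tab pab))// (le_trans _ Ld)// ler_wpM2l.
  have xt : `|x p - x t| <= e / 4.
    rewrite distrC (le_trans (xL _ _ tab pab))// (le_trans _ Ld)//.
    by rewrite ler_wpM2l.
  have := xs p ps => xp.
  rewrite -(subrKA (z p)) -[X in _ + X](subrKA (x p)).
  rewrite (le_trans (ler_normD _ _))//.
  have := ler_normD (z p - x p) (x p - x t); lra.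
exists z; split=> //; split=> //.
rewrite leNgt; apply/negP => Mz.
have cv : `|x : Cab a b| @[x --> F] --> `|z| by exact: cvg_norm.
have gt : F [set x : Cab a b | M < `|x|] by exact: (cvgr_gt _ cv _ Mz).
have [x [[xM _] /=]] := filter_ex (filterI FK1 gt).
by rewrite ltNge xM.
Qed.

End LipschitzCab.

(** * Primitives of essentially bounded functions *)

Lemma norm_lipschitz_continuous {R : realType} {V W : normedModType R} (k : R)
    (f : V -> W) : 0 <= k -> (forall x y, `|f x - f y| <= k * `|x - y|) ->
  continuous f.
Proof.
move=> k0 fk x; apply/cvgrPdist_lt => e e0.
apply/nbhs_ballP; exists (e / (k + 1)) => /=.
  by rewrite divr_gt0// ltr_wpDl.
move=> y; rewrite -ball_normE /= ltr_pdivlMr ?ltr_wpDl// => xy.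
rewrite (le_lt_trans (fk _ _))//.
by apply: le_lt_trans xy; rewrite mulrC ler_wpM2l// lerDl.
Qed.

Section Primitive.
Context {R : realType} (a b : R).
Local Notation mu := (@lebesgue_measure R).
Local Notation RR := (measurableTypeR R).
Implicit Types (X Y : Linfty a b) (s t : R).

#[local] Instance lebesgue_ae_filter : Filter (nbhs (almost_everywhere mu)).
Proof. exact: (ae_filter_ringOfSetsType mu). Qed.

(** Integrals over subintervals of [[a, b]] are taken with respect to the Lebesgue
    measure itself; this transfers statements from its restriction. *)
Lemma ae_mu_abP (P : R -> Prop) :
  (\forall t \ae mu_ab a b, P t) <-> (\forall t \ae mu, t \in `[a, b] -> P t).
Proof.
split=> -[N [mN N0 PN]].
  exists (N `&` `[a, b]); split; [exact: measurableI|exact: N0|].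
  by move=> t /= /not_implyP[tab nPt]; split => //; exact: PN.
exists (N `|` ~` `[a, b]); split.
- by apply: measurableU => //; exact: measurableC.
- rewrite /mu_ab /= /mrestr setIUl setICl setU0.
  by apply: (@subset_measure0 _ _ _ mu _ N) => //; [exact: measurableI].
- move=> t /= nPt; have [tab|tab] := boolP (t \in `[a, b]).
    by left; apply: PN => /= /(_ tab).
  by right => /= tab'; rewrite tab' in tab.
Qed.

Lemma ae_itvoo : \forall t \ae mu_ab a b, t \in `]a, b[.
Proof.
apply/(ae_mu_abP (fun t => t \in `]a, b[)).
exists [set a; b]; split; first exact: measurableU.
  apply/eqP; rewrite -measure_le0 (le_trans (measureU2 _ _ _))//.
  by rewrite /= !lebesgue_measure_set1 adde0.
move=> t /= /not_implyP[]; rewrite !in_itv/= => /andP[at_ tb].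
rewrite !lt_neqAle at_ tb !andbT => /negP.
by rewrite negb_and !negbK => /orP[/eqP ->|/eqP ->]; [left|right].
Qed.

Lemma Linfty_measurable_on X (D : set RR) : measurable D ->
  measurable_fun D (X : RR -> RR).
Proof. by move=> mD; apply: measurable_funTS; exact: Linfty_measurable. Qed.

Lemma Linfty_integrable X : mu.-integrable `[a, b] (EFin \o X).
Proof.
apply/integrableP; split.
  by apply/measurable_EFinP; exact: Linfty_measurable_on.
apply: (@le_lt_trans _ _ (\int[mu]_(t in `[a, b]) (`|X|)%:E)%E); last first.
  rewrite integral_cst//= lebesgue_measure_itv/=.
  by case: ifP => _; rewrite ?mule0 ?ltry// -EFinB -EFinM ltry.
apply: ae_ge0_le_integral => //.
- apply: measurableT_comp => //; apply/measurable_EFinP.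
  exact: Linfty_measurable_on.
- have /ae_mu_abP := Linfty_le_norm X.
  by apply: filterS => t /= Xt tab; rewrite lee_fin Xt.
Qed.

Lemma itv_sub_ab s t : a <= s -> t <= b -> `]s, t] `<=` `[a, b].
Proof.
move=> as_ tb u /=; rewrite !in_itv /= => /andP[su ut].
by rewrite (ltW (le_lt_trans as_ su)) (le_trans ut).
Qed.

Definition prim X t : R := \int[mu]_(u in `[a, t]) X u.

Lemma prim_increment X s t : a <= s -> s <= t -> t <= b ->
  prim X t - prim X s = \int[mu]_(u in `]s, t]) X u.
Proof.
move=> as_ st tb; rewrite /prim Rintegral_itvB//.
apply: integrableS (Linfty_integrable X) => // u /=.
by rewrite !in_itv /= => /andP[-> ut]; rewrite (le_trans ut).
Qed.

Lemma primB X Y t : a <= t -> t <= b -> prim (X - Y) t = prim X t - prim Y t.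
Proof.
move=> at_ tb; have sub : `[a, t] `<=` `[a, b].
  by move=> u /=; rewrite !in_itv /= => /andP[-> ut]; rewrite (le_trans ut).
rewrite /prim -RintegralB//; last 2 first.
- exact: integrableS (Linfty_integrable X).
- exact: integrableS (Linfty_integrable Y).
congr fine; apply: ae_eq_integral => //.
- by apply/measurable_EFinP; exact: Linfty_measurable_on.
- apply: measurable_funTS; apply/measurable_EFinP/measurable_funB;
    exact: Linfty_measurable.
have /ae_mu_abP h1 := LinftyD X (- Y); have /ae_mu_abP h2 := LinftyN Y.
apply: filterS2 h1 h2 => u h1 h2 /sub uab /=.
by rewrite h1// h2.
Qed.

Lemma integrable_cst_itv (k s t : R) : mu.-integrable `]s, t] (EFin \o cst k).
Proof.
apply: measurable_bounded_integrable => //.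
- rewrite /= lebesgue_measure_itv/=.
  by case: ifP => _; rewrite ?ltry// -EFinB ltry.
- by exists `|k|; split => // M kM x _ /=; exact: ltW.
Qed.

Lemma prim_increment_le X k s t : (\forall u \ae mu_ab a b, X u <= k) ->
  a <= s -> s <= t -> t <= b -> prim X t - prim X s <= k * (t - s).
Proof.
move=> Xk as_ st tb; rewrite prim_increment//.
have sub := itv_sub_ab as_ tb.
have intX : mu.-integrable `]s, t] (EFin \o X).
  by apply: integrableS (Linfty_integrable X).
have -> : k * (t - s) = \int[mu]_(u in `]s, t]) k.
  rewrite Rintegral_cst//= lebesgue_measure_itv/=; case: ifPn => //=.
  rewrite lte_fin -leNgt => ts.
  by rewrite (@le_anti _ _ s t) ?st ?ts// subrr mulr0.
rewrite -subr_ge0 -RintegralB//; last exact: integrable_cst_itv.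
(* The integrand is only nonnegative almost everywhere; replacing it by its
   absolute value makes it nonnegative everywhere. *)
rewrite /Rintegral (@ae_eq_integral _ _ _ _ _ (fun u => `|k - X u|%:E))//.
- by apply: fine_ge0; apply: integral_ge0 => u _; rewrite lee_fin.
- apply/measurable_EFinP; apply: measurable_funTS; apply: measurable_funB => //.
  exact: Linfty_measurable.
- apply/measurable_EFinP; apply: measurable_funTS; apply: measurableT_comp => //.
  apply: measurable_funB => //; exact: Linfty_measurable.
have /ae_mu_abP := Xk; apply: filterS => u Xu /sub uab /=.
by rewrite ger0_norm// subr_ge0 Xu.
Qed.

Lemma prim_start X : prim X a = 0.
Proof. by rewrite /prim set_itv1 Rintegral_set1. Qed.

Lemma prim_increment_ge X k s t : (\forall u \ae mu_ab a b, - k <= X u) ->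
  a <= s -> s <= t -> t <= b -> - (k * (t - s)) <= prim X t - prim X s.
Proof.
move=> Xk as_ st tb; have at_ := le_trans as_ st; have sb := le_trans st tb.
have prim0 u : a <= u -> u <= b -> prim (0 : Linfty a b) u = 0.
  by move=> au ub; rewrite -(subrr X) primB// subrr.
have : prim (0 - X) t - prim (0 - X) s <= k * (t - s).
  apply: prim_increment_le => //; rewrite sub0r.
  by apply: filterS2 Xk (LinftyN X) => u Xu ->; rewrite lerNl.
by rewrite !primB// !prim0//; lra.
Qed.

Lemma prim_lipschitz X : lipschitz_itv a b `|X| (prim X).
Proof.
have le s t : a <= s -> s <= t -> t <= b ->
    `|prim X t - prim X s| <= `|X| * (t - s).
  move=> as_ st tb; rewrite ler_norml prim_increment_ge ?prim_increment_le//.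
  - by apply: filterS (Linfty_le_norm X) => u; exact: le_trans (ler_norm _).
  - by apply: filterS (Linfty_le_norm X) => u; rewrite ler_norml => /andP[].
move=> s t; rewrite !in_itv /= => /andP[as_ sb] /andP[at_ tb].
have [st|/ltW ts] := leP s t.
  by rewrite distrC (distrC s) (ger0_norm (x := t - s)) ?subr_ge0// le.
by rewrite (ger0_norm (x := s - t)) ?subr_ge0// le.
Qed.

Definition Cab_prim X : Cab a b :=
  MkCab (lipschitz_itv_Cab (normr_ge0 X) (@prim_lipschitz X)).

Lemma Cab_primE X t : t \in `[a, b] -> Cab_prim X t = prim X t.
Proof. by move=> tab; rewrite /= patchE mem_set. Qed.

Lemma Cab_prim_lipschitz X : lipschitz_itv a b `|X| (Cab_prim X).
Proof. by move=> s t sab tab; rewrite !Cab_primE// prim_lipschitz. Qed.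

Lemma Cab_primB X Y : Cab_prim (X - Y) = Cab_prim X - Cab_prim Y.
Proof.
apply: Cab_eq => t; have [tab|tab] := boolP (t \in `[a, b]); last first.
  by rewrite !Cab_out.
have /andP[at_ tb] : (a <= t) && (t <= b) by rewrite in_itv in tab.
change (Cab_prim (X - Y) t = Cab_prim X t - Cab_prim Y t).
by rewrite !Cab_primE// primB.
Qed.

Lemma Cab_prim_start X : a <= b -> Cab_prim X a = 0.
Proof. by move=> ab; rewrite Cab_primE ?bound_itvE// prim_start. Qed.

Lemma Cab_prim_norm X : a <= b -> `|Cab_prim X| <= (b - a) * `|X|.
Proof.
move=> ab; have ba : 0 <= b - a by rewrite subr_ge0.
apply/Cab_normP => [|t tab]; first exact: mulr_ge0.
rewrite -[Cab_prim X t]subr0 -(Cab_prim_start X ab).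
have aab : a \in `[a, b] by rewrite bound_itvE.
rewrite (le_trans (Cab_prim_lipschitz X tab aab))// mulrC ler_wpM2r//.
move: tab; rewrite in_itv /= => /andP[at_ tb].
by rewrite ger0_norm ?subr_ge0// lerB.
Qed.

Lemma Cab_prim_continuous : a <= b -> continuous Cab_prim.
Proof.
move=> ab; apply: (@norm_lipschitz_continuous _ _ _ (b - a)).
  by rewrite subr_ge0.
by move=> X Y; rewrite -Cab_primB Cab_prim_norm.
Qed.

(** Lebesgue's differentiation theorem, applied to [X] cut off outside
    [[a, b]]; at interior points the cut-off is not seen. *)
Lemma Cab_prim_is_derive X :
  \forall t \ae mu_ab a b, is_derive t (1 : R) (Cab_prim X : R -> R) (X t).
Proof.
pose f : R -> R := (X : R -> R) \_ `[a, b].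
have intf : mu.-integrable setT (EFin \o f).
  by rewrite /f -restrict_EFin -integrable_mkcond//; exact: Linfty_integrable.
have intfy y : mu.-integrable `[a, y] (EFin \o f) by apply: integrableS intf.
have locf : locally_integrable setT f.
  by apply: open_integrable_locally => //; exact: openT.
have /= FTC := @FTC1 R f (BLeft a) intfy locf.
apply/(ae_mu_abP (fun t => is_derive t (1 : R) (Cab_prim X : R -> R) (X t))).
have /ae_mu_abP := ae_itvoo.
apply: filterS2 FTC => t FTC tab_oo tab.
have tab_int := tab_oo tab; have := tab_int; rewrite in_itv /= => /andP[at_ tb].
have [dF F't] : derivable (fun x => \int[mu]_(u in `[a, x]) f u) t 1 /\
    derive1 (fun x => \int[mu]_(u in `[a, x]) f u) t = f t.
  by apply: FTC; rewrite lte_fin.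
have -> : X t = f t by rewrite /f patchE mem_set.
apply: (@near_eq_is_derive _ _ _ (fun x => \int[mu]_(u in `[a, x]) f u)).
  near=> x; have xab : x \in `]a, b[ by near: x; exact: near_in_itvoo.
  rewrite -[RHS]/(Cab_prim X x) Cab_primE; last exact: subset_itv_oo_cc.
  apply: eq_Rintegral => u /set_mem /=; rewrite in_itv /= => /andP[au ux].
  rewrite /f patchE mem_set//= in_itv/= au (le_trans ux)//.
  by move: xab; rewrite in_itv /= => /andP[_ /ltW].
by apply: DeriveDef => //; rewrite -derive1E.
Unshelve. all: by end_near. Qed.

End Primitive.

(** * The a priori estimate for increments *)

Definition solv_poly {R : realType} (A B t : R) : R :=
  (B ^+ 2 - A ^+ 2) * t ^+ 2 + (A ^+ 2 - B ^+ 2 + B) * t + 1 - A.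

Lemma solv_poly_lower_bound {R : realType} (A B : R) :
  (forall t, 0 <= t <= 1 -> solv_poly A B t > 0) ->
  exists2 d, 0 < d & forall t, 0 <= t <= 1 -> d <= solv_poly A B t.
Proof.
move=> pos; have cc : {within `[0, 1], continuous (solv_poly A B)}.
  apply: continuous_subspaceT => t.
  pose p : {poly R} :=
    (B ^+ 2 - A ^+ 2) *: 'X^2 + (A ^+ 2 - B ^+ 2 + B) *: 'X + 1 - A%:P.
  have -> : solv_poly A B = (fun t => p.[t]).
    by apply/funext => u; rewrite /solv_poly /p !hornerE.
  exact: continuous_horner.
have [t t01 tmin] := EVT_min ler01 cc.
exists (solv_poly A B t) => [|s s01]; first by apply: pos; move: t01; rewrite in_itv.
by apply: tmin; rewrite in_itv.
Qed.

(** The first summand bounds n / e and the second one M / e in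
    [two_increments_bound]. *)
Definition apriori_const {R : realType} (B d : R) : R :=
  (B + 1) / d + ((B + 1) / d * B + 1) / d.

Lemma apriori_const_ge0 {R : realType} (B d : R) : 0 <= B -> 0 < d ->
  0 <= apriori_const B d.
Proof.
move=> B0 d0; have dV0 : 0 <= d^-1 by rewrite invr_ge0 ltW.
by rewrite /apriori_const !(addr_ge0, mulr_ge0).
Qed.

(** The first inequality reads M (1 - t A) <= t n B + e, the second one
    n (1 - (1 - t) A) <= M ((1 - t) B - 1) + e, and A < 1 because the quadratic
    at 0 is 1 - A.  If (1 - t) B <= 1 the second one bounds n directly.
    Otherwise multiply it by 1 - t A and insert the first one: the coefficient of
    n becomes the quadratic at t. *)
Lemma two_increments_bound {R : realType} (A B d t M n e : R) :
  0 <= A -> 0 <= B -> 0 < d -> (forall s, 0 <= s <= 1 -> d <= solv_poly A B s) ->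
  0 <= t <= 1 -> 0 <= M -> 0 <= n -> 0 <= e ->
  M <= t * (M * A + n * B) + e -> M + n <= (1 - t) * (n * A + M * B) + e ->
  M <= apriori_const B d * e /\ n <= apriori_const B d * e.
Proof.
move=> A0 B0 d0 d_le /andP[t0 t1] M0 n0 e0 HM Hn.
have dA : d <= 1 - A.
  by have := d_le 0; rewrite /solv_poly lexx ler01 => /(_ erefl); lra.
have tA : t * A <= A by rewrite ler_piMl.
have tA0 : 0 <= t * A by rewrite mulr_ge0.
have sA : (1 - t) * A <= A by rewrite ler_piMl// lerBlDr lerDl.
have nd : n * d <= e * (B + 1).
  have HM' : M * (1 - t * A) <= t * n * B + e by nra.
  have Hn' : n * (1 - (1 - t) * A) <= M * ((1 - t) * B - 1) + e by nra.
  have [sB|sB] := leP ((1 - t) * B) 1.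
    have h1 : M * ((1 - t) * B - 1) <= 0 by nra.
    have h2 : n * d <= n * (1 - (1 - t) * A) by nra.
    nra.
  have h1 : M * (1 - t * A) * ((1 - t) * B - 1) <=
      (t * n * B + e) * ((1 - t) * B - 1).
    by rewrite ler_wpM2r// subr_ge0 ltW.
  have h2 : n * (1 - (1 - t) * A) * (1 - t * A) <=
      M * ((1 - t) * B - 1) * (1 - t * A) + e * (1 - t * A).
    by rewrite -mulrDl ler_wpM2r//; lra.
  have h3 : n * d <= n * solv_poly A B t.
    by rewrite ler_wpM2l// d_le// t0 t1.
  have h4 : n * solv_poly A B t <= e * ((1 - t) * B - t * A).
    by rewrite /solv_poly; nra.
  have h5 : e * ((1 - t) * B - t * A) <= e * (B + 1).
    by rewrite ler_wpM2l//; nra.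
  lra.
have nle : n <= (B + 1) / d * e.
  by rewrite mulrAC ler_pdivlMr// [X in _ <= X]mulrC.
have Md : M * d <= n * B + e.
  have : M * d <= M * (1 - t * A) by rewrite ler_wpM2l//; lra.
  have : t * (n * B) <= n * B by rewrite ler_piMl// mulr_ge0.
  nra.
have K0 : 0 <= (B + 1) / d by rewrite divr_ge0 ?addr_ge0// ltW.
have Mle : M <= ((B + 1) / d * B + 1) / d * e.
  rewrite mulrAC ler_pdivlMr// (le_trans Md)// mulrDl mul1r lerD2r.
  by rewrite mulrAC ler_wpM2r.
have K1 : 0 <= ((B + 1) / d * B + 1) / d.
  by apply: divr_ge0; [rewrite addr_ge0// mulr_ge0|exact: ltW].
rewrite /apriori_const mulrDl; split.
  by rewrite (le_trans Mle)// lerDr mulr_ge0.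
by rewrite (le_trans nle)// lerDl mulr_ge0.
Qed.

Section Apriori.
Context {R : realType} (a b : R).
Hypothesis ab : a < b.
Variables (p q d e : R).
Local Notation h := (b - a).
Hypotheses (p0 : 0 <= p) (q0 : 0 <= q) (d0 : 0 < d) (e0 : 0 <= e).
Hypothesis d_le : forall t, 0 <= t <= 1 -> d <= solv_poly (h * p) (h * q) t.

(** Stated for two ordered points, with [M] and [n] interchangeable, so as to serve
    both orders of the points of maximum and minimum. *)
Lemma extrema_bound (M n t1 t2 : R) : a <= t1 -> t1 <= t2 -> t2 <= b ->
  0 <= M -> 0 <= n ->
  M <= (M * p + n * q + e) * (t1 - a) ->
  M + n <= (n * p + M * q + e) * (t2 - t1) ->
  M <= apriori_const (h * q) d * (h * e) /\
  n <= apriori_const (h * q) d * (h * e).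
Proof.
move=> at1 t12 t2b M0 n0 HM Hn; have h0 : 0 < h by rewrite subr_gt0.
pose t := (t1 - a) / h.
have tE : t1 - a = t * h by rewrite /t divfK// gt_eqF.
have t0 : 0 <= t by rewrite /t divr_ge0 ?subr_ge0// ltW.
have t1le : t <= 1 by rewrite /t ler_pdivrMr// mul1r; lra.
have he : 0 <= h * e by rewrite mulr_ge0// ltW.
apply: (@two_increments_bound _ (h * p) (h * q) d t) => //.
- by rewrite mulr_ge0// ltW.
- by rewrite mulr_ge0// ltW.
- by rewrite t0 t1le.
- rewrite (le_trans HM)// tE.
  have -> : (M * p + n * q + e) * (t * h) =
      t * (M * (h * p) + n * (h * q)) + t * (h * e).
    by ring.
  by rewrite lerD2l ler_piMl.
- have s0 : 0 <= n * p + M * q + e by rewrite !addr_ge0 ?mulr_ge0.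
  have t21 : t2 - t1 <= (1 - t) * h by rewrite mulrBl mul1r -tE; lra.
  apply: (le_trans (le_trans Hn (ler_wpM2l s0 t21))).
  have -> : (n * p + M * q + e) * ((1 - t) * h) =
      (1 - t) * (n * (h * p) + M * (h * q)) + (1 - t) * (h * e) by ring.
  by rewrite lerD2l ler_piMl//; lra.
Qed.

(** The hypothesis on increments is the integrated form of
    - (n p + M q + e) <= y' <= M p + n q + e. *)
Lemma increments_apriori (y : Cab a b) : y a = 0 ->
  (forall M n : R, (forall t, t \in `[a, b] -> - n <= y t <= M) ->
    forall s t, a <= s -> s <= t -> t <= b ->
    y t - y s <= (M * p + n * q + e) * (t - s) /\
    y s - y t <= (n * p + M * q + e) * (t - s)) ->
  `|y| <= apriori_const (h * q) d * (h * e).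
Proof.
move=> ya inc.
have [t1 t1ab t1max] := @EVT_max _ y _ _ (ltW ab) (@Cab_continuous _ _ _ y).
have [t2 t2ab t2min] := @EVT_min _ y _ _ (ltW ab) (@Cab_continuous _ _ _ y).
pose M := y t1; pose n := - y t2.
have aab : a \in `[a, b] by rewrite bound_itvE ltW.
have M0 : 0 <= M by rewrite -ya t1max.
have n0 : 0 <= n by rewrite oppr_ge0 -ya t2min.
have {}inc := inc M n.
have {}inc : forall s t, a <= s -> s <= t -> t <= b ->
    y t - y s <= (M * p + n * q + e) * (t - s) /\
    y s - y t <= (n * p + M * q + e) * (t - s).
  by apply: inc => t tab; rewrite opprK t2min// t1max.
have [at1 t1b] : a <= t1 /\ t1 <= b by move: t1ab; rewrite in_itv /= => /andP.
have [at2 t2b] : a <= t2 /\ t2 <= b by move: t2ab; rewrite in_itv /= => /andP.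
have [ML nL] : M <= apriori_const (h * q) d * (h * e) /\
               n <= apriori_const (h * q) d * (h * e).
  have [t12|/ltW t21] := leP t1 t2.
    apply: (extrema_bound at1 t12 t2b M0 n0).
      by have [+ _] := inc a t1 (lexx a) at1 t1b; rewrite ya subr0.
    by have [_] := inc t1 t2 at1 t12 t2b.
  apply/and_comm; apply: (extrema_bound at2 t21 t1b n0 M0).
    by have [_] := inc a t2 (lexx a) at2 t2b; rewrite ya sub0r.
  by have [+ _] := inc t2 t1 at2 t21 t1b; rewrite [n + M]addrC.
apply/Cab_normP => [|t tab]; first exact: le_trans ML.
rewrite ler_norml (le_trans (t1max t tab) ML) andbT.
by rewrite (le_trans _ (t2min t tab))// lerNl.
Qed.

End Apriori.

(** * The Cauchy problem *)

Lemma lipschitz_abs_continuous {R : realType} (a b L : R) (f : R -> R) :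
  0 <= L -> lipschitz_itv a b L f -> abs_continuous a b f.
Proof.
move=> L0 fL e e0; have L1 : 0 < L + 1 by rewrite ltr_wpDl.
exists (e / (L + 1)) => [|n u v uv _]; first by rewrite divr_gt0.
rewrite ltr_pdivlMr// => sum_lt; apply: le_lt_trans sum_lt.
rewrite mulr_suml; apply: ler_sum => i _; have [au uvi vb] := uv i.
have uab : u i \in `[a, b] by rewrite in_itv /= au (le_trans uvi).
have vab : v i \in `[a, b] by rewrite in_itv /= vb (le_trans au).
rewrite (le_trans (fL _ _ vab uab))// ger0_norm ?subr_ge0//.
by rewrite mulrC ler_wpM2l ?subr_ge0// lerDl.
Qed.

Lemma LinftyB {R : realType} (a b : R) (X Y : Linfty a b) :
  \forall t \ae mu_ab a b, (X - Y) t = X t - Y t.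
Proof. by apply: filterS2 (LinftyD X (- Y)) (LinftyN Y) => t -> ->. Qed.

Section PositiveOperator.
Context {R : realType} (a b : R) (T : {linear Cab a b -> Linfty a b}).
Hypotheses (ab : a < b) (T_pos : positive_op T).
Local Notation one := (Cab_one a b).
Local Notation P := (positive_op_norm T).

Lemma positive_op_one_norm_le : `|T one| <= P.
Proof.
rewrite positive_op_normE//; apply: ub_le_sup; last first.
  by exists one => //; exact: Cab_norm_one_le.
exists `|T one| => _ [x x1 <-]; apply/Linfty_normP => //.
apply: filterS2 (positive_op_le_one T_pos x1) (Linfty_le_norm (T one)).
by move=> t Tx T1; rewrite (le_trans Tx)// (le_trans _ T1)// ler_norm.
Qed.

Lemma positive_op_norm_ge0 : 0 <= P.
Proof. exact: le_trans positive_op_one_norm_le. Qed.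

Lemma positive_op_le_cst (y : Cab a b) (M : R) : 0 <= M ->
  (forall t, t \in `[a, b] -> y t <= M) ->
  \forall t \ae mu_ab a b, T y t <= M * P.
Proof.
move=> M0 yM.
have /T_pos : forall t, t \in `[a, b] -> 0 <= (M *: one - y) t.
  move=> t tab; change (0 <= M * one t - y t).
  by rewrite Cab_oneE// mulr1 subr_ge0 yM.
have -> : T (M *: one - y) = M *: T one - T y by rewrite linearB linearZZ.
move=> Ty.
have T1 : \forall t \ae mu_ab a b, (M *: T one) t <= M * P.
  apply: filterS2 (LinftyZ M (T one)) (Linfty_le_norm (T one)) => t -> T1.
  rewrite ler_wpM2l// (le_trans (ler_norm _))// (le_trans T1)//.
  exact: positive_op_one_norm_le.
apply: filterS3 Ty (LinftyB (M *: T one) (T y)) T1 => t + E1.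
by rewrite E1 subr_ge0; exact: le_trans.
Qed.

Lemma positive_op_ge_cst (y : Cab a b) (n : R) : 0 <= n ->
  (forall t, t \in `[a, b] -> - n <= y t) ->
  \forall t \ae mu_ab a b, - (n * P) <= T y t.
Proof.
move=> n0 yn; have : \forall t \ae mu_ab a b, T (- y) t <= n * P.
  apply: positive_op_le_cst => // t tab.
  by change (- y t <= n); rewrite lerNl yn.
rewrite linearN => Ty.
by apply: filterS2 Ty (LinftyN (T y)) => t + E1; rewrite E1 lerNl.
Qed.

Lemma positive_op_bound (y : Cab a b) : `|T y| <= P * `|y|.
Proof.
apply/Linfty_normP; first by rewrite mulr_ge0// positive_op_norm_ge0.
have y_bd t : t \in `[a, b] -> - `|y| <= y t <= `|y|.
  by move=> _; rewrite -ler_norml; exact: Cab_le_norm.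
have le1 := @positive_op_le_cst y `|y| (normr_ge0 y)
  (fun t tab => proj2 (andP (y_bd t tab))).
have ge1 := @positive_op_ge_cst y `|y| (normr_ge0 y)
  (fun t tab => proj1 (andP (y_bd t tab))).
by apply: filterS2 le1 ge1 => t h1 h2; rewrite ler_norml mulrC h2.
Qed.

Lemma positive_op_dist (x y : Cab a b) (k : R) : `|x - y| <= k ->
  \forall t \ae mu_ab a b, `|T x t - T y t| <= k * P.
Proof.
move=> xy; have k0 : 0 <= k by exact: le_trans xy.
have : `|T x - T y| <= k * P.
  rewrite -linearB (le_trans (positive_op_bound _))// mulrC ler_wpM2r//.
  exact: positive_op_norm_ge0.
move=> /(Linfty_normP _ (mulr_ge0 k0 positive_op_norm_ge0)) Txy.
by apply: filterS2 Txy (LinftyB (T x) (T y)) => t + E1; rewrite E1.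
Qed.

Lemma positive_op_continuous : continuous T.
Proof.
apply: (norm_lipschitz_continuous positive_op_norm_ge0) => x y.
by rewrite -linearB positive_op_bound.
Qed.

End PositiveOperator.

Section CauchyProblem.
Context {R : realType} (a b : R) (Tp Tm : {linear Cab a b -> Linfty a b}).
Variables (F : Cab a b -> Linfty a b) (c : R).
Hypotheses (ab : a < b) (Tp_pos : positive_op Tp) (Tm_pos : positive_op Tm).
Local Notation one := (Cab_one a b).
Local Notation P := (positive_op_norm Tp).
Local Notation Q := (positive_op_norm Tm).

Definition cauchy_rhs (x : Cab a b) : Linfty a b := Tp x - Tm x + F x.

Definition cauchy_map (x : Cab a b) : Cab a b :=
  c *: one + Cab_prim (cauchy_rhs x).

Lemma cauchy_rhsE x :
  \forall t \ae mu_ab a b, cauchy_rhs x t = Tp x t - Tm x t + F x t.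
Proof.
by apply: filterS2 (LinftyD (Tp x - Tm x) (F x)) (LinftyB (Tp x) (Tm x))
  => t -> ->.
Qed.

Lemma cauchy_mapE x t : t \in `[a, b] ->
  cauchy_map x t = c + Cab_prim (cauchy_rhs x) t.
Proof.
move=> tab; rewrite -[LHS]/(c * one t + Cab_prim (cauchy_rhs x) t).
by rewrite Cab_oneE// mulr1.
Qed.

Lemma cauchy_map_continuous : continuous F -> continuous cauchy_map.
Proof.
move=> Fc; have rhs_cont : continuous cauchy_rhs.
  move=> x; apply: (@continuousD R _ _ (fun x => Tp x - Tm x) F);
    last exact: Fc.
  by apply: (@continuousB R _ _ Tp Tm); exact: positive_op_continuous.
move=> x; apply: (@continuousD R _ _ (fun=> c *: one)
  (@Cab_prim R a b \o cauchy_rhs)).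
  exact: cst_continuous.
apply: continuous_comp; first exact: rhs_cont.
exact: Cab_prim_continuous (ltW ab) _.
Qed.

Lemma cauchy_rhs_norm x : `|cauchy_rhs x| <= (P + Q) * `|x| + `|F x|.
Proof.
rewrite (le_trans (ler_normD _ _))// lerD2r (le_trans (ler_normB _ _))//.
by rewrite mulrDl lerD// positive_op_bound.
Qed.

Lemma cauchy_map_lipschitz x : lipschitz_itv a b `|cauchy_rhs x| (cauchy_map x).
Proof.
move=> s t sab tab; rewrite !cauchy_mapE//.
by rewrite opprD addrACA subrr add0r Cab_prim_lipschitz.
Qed.

Lemma cauchy_map_compact (M r : R) : 0 <= r -> 0 <= M ->
  (forall x, `|x| <= r -> `|F x| <= M) ->
  exists2 K : set (Cab a b), compact K &
    forall x, `|x| <= r -> K (cauchy_map x).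
Proof.
move=> r0 M0 FM; pose L := (P + Q) * r + M.
have PQ0 : 0 <= P + Q by rewrite addr_ge0// positive_op_norm_ge0.
have L0 : 0 <= L by rewrite addr_ge0// mulr_ge0.
have ba : 0 <= b - a by rewrite subr_ge0 ltW.
exists (lipschitz_ball (`|c| + (b - a) * L) L).
  by apply: compact_lipschitz_ball => //; rewrite addr_ge0// mulr_ge0.
move=> x xr; have ZL : `|cauchy_rhs x| <= L.
  by rewrite (le_trans (cauchy_rhs_norm x))// lerD ?FM// ler_wpM2l.
split.
  rewrite (le_trans (ler_normD _ _))// lerD//.
    by rewrite normrZ ler_piMr// Cab_norm_one_le.
  by rewrite (le_trans (Cab_prim_norm _ (ltW ab)))// ler_wpM2l.
move=> s t sab tab; rewrite (le_trans (cauchy_map_lipschitz x sab tab))//.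
by rewrite ler_wpM2r.
Qed.

(** Replacing x by y = x - l c costs at most |c| (P + Q) in T+ and T-, by
    [positive_op_dist]; the rest is [increments_apriori] for y. *)
Lemma cauchy_map_apriori d (x : Cab a b) (l : R) : 0 < d ->
  (forall t, 0 <= t <= 1 -> d <= solv_poly ((b - a) * P) ((b - a) * Q) t) ->
  0 <= l <= 1 -> x = l *: cauchy_map x ->
  `|x| <= `|c| + apriori_const ((b - a) * Q) d *
                 ((b - a) * (`|c| * (P + Q) + `|F x|)).
Proof.
move=> d0 d_le /andP[l0 l1] xE.
pose e := `|c| * (P + Q) + `|F x|.
have P0 : 0 <= P by exact: positive_op_norm_ge0.
have Q0 : 0 <= Q by exact: positive_op_norm_ge0.
have e0 : 0 <= e by rewrite addr_ge0// mulr_ge0// addr_ge0.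
pose k := l * c; pose y := l *: Cab_prim (cauchy_rhs x).
have kc : `|k| <= `|c| by rewrite normrM ger0_norm// ler_piMl.
have xky : x = k *: one + y by rewrite {1}xE scalerDr scalerA.
have one1 := Cab_norm_one_le a b.
rewrite {1}xky (le_trans (ler_normD _ _))// lerD//.
  by rewrite normrZ (le_trans _ kc)// ler_piMr.
apply: (increments_apriori ab P0 Q0 d0 e0 d_le).
  rewrite -[LHS]/(l * Cab_prim (cauchy_rhs x) a).
  by rewrite Cab_prim_start ?mulr0// ltW.
move=> M n yMn.
have aab : a \in `[a, b] by rewrite bound_itvE ltW.
have ya : y a = 0.
  rewrite -[LHS]/(l * Cab_prim (cauchy_rhs x) a).
  by rewrite Cab_prim_start ?mulr0// ltW.
have /andP[n0 M0] : (0 <= n) && (0 <= M).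
  by have := yMn a aab; rewrite ya oppr_le0.
have yM t : t \in `[a, b] -> y t <= M by move=> /yMn/andP[].
have yn t : t \in `[a, b] -> - n <= y t by move=> /yMn/andP[].
have TpM := positive_op_le_cst ab Tp_pos M0 yM.
have Tpn := positive_op_ge_cst ab Tp_pos n0 yn.
have TmM := positive_op_le_cst ab Tm_pos M0 yM.
have Tmn := positive_op_ge_cst ab Tm_pos n0 yn.
have xy : `|x - y| <= `|c|.
  by rewrite xky addrK normrZ (le_trans _ kc)// ler_piMr.
have Tpd := positive_op_dist ab Tp_pos xy.
have Tmd := positive_op_dist ab Tm_pos xy.
have Zbound : \forall u \ae mu_ab a b,
    - (n * P + M * Q + e) <= cauchy_rhs x u <= M * P + n * Q + e.
  near=> u.
  have E1 : cauchy_rhs x u = Tp x u - Tm x u + F x u.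
    by near: u; exact: cauchy_rhsE.
  have h1 : Tp y u <= M * P by near: u.
  have h2 : - (n * P) <= Tp y u by near: u.
  have h3 : Tm y u <= M * Q by near: u.
  have h4 : - (n * Q) <= Tm y u by near: u.
  have : `|Tp x u - Tp y u| <= `|c| * P by near: u.
  have : `|Tm x u - Tm y u| <= `|c| * Q by near: u.
  have : `|F x u| <= `|F x| by near: u; exact: Linfty_le_norm.
  rewrite E1 /e !ler_norml; lra.
have Zle : \forall u \ae mu_ab a b, cauchy_rhs x u <= M * P + n * Q + e.
  by apply: filterS Zbound => u /andP[].
have Zge : \forall u \ae mu_ab a b, - (n * P + M * Q + e) <= cauchy_rhs x u.
  by apply: filterS Zbound => u /andP[].
move=> s t as_ st tb.
have sab : s \in `[a, b] by rewrite in_itv /= as_ (le_trans st).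
have tab : t \in `[a, b] by rewrite in_itv /= tb (le_trans as_).
have yE u : u \in `[a, b] -> y u = l * prim (cauchy_rhs x) u.
  move=> uab; rewrite -[LHS]/(l * Cab_prim (cauchy_rhs x) u).
  by rewrite Cab_primE.
have scale (w K : R) : 0 <= K -> w <= K -> l * w <= K.
  by move=> K0 wK; rewrite (le_trans (ler_wpM2l l0 wK))// ler_piMl.
rewrite !yE// -!mulrBr; split; apply: scale.
- by apply: mulr_ge0; rewrite ?subr_ge0// !(addr_ge0, mulr_ge0).
- exact: prim_increment_le.
- by apply: mulr_ge0; rewrite ?subr_ge0// !(addr_ge0, mulr_ge0).
- by rewrite -opprB lerNl; exact: prim_increment_ge.
Unshelve. all: by end_near. Qed.

End CauchyProblem.

Theorem corollary3 (R : realType) (a b : R) (hab : a < b)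
    (Tp Tm : {linear Cab a b -> Linfty a b})
    (Tp_pos : positive_op Tp) (Tm_pos : positive_op Tm)
    (A B : R)
    (hA : A = (b - a) * positive_op_norm Tp)
    (hB : B = (b - a) * positive_op_norm Tm)
    (hAB : forall t : R, 0 <= t <= 1 ->
      (B ^+ 2 - A ^+ 2) * t ^+ 2 + (A ^+ 2 - B ^+ 2 + B) * t + 1 - A > 0)
    (F : Cab a b -> Linfty a b)
    (F_continuous : continuous F)
    (F_bounded : forall S : set (Cab a b),
      bounded_set S -> bounded_set (F @` S))
    (F_sublinear : `|F x| / `|x| @[x --> norm_infty (Cab a b)] --> (0 : R))
    (c : R) :
  exists x : Cab a b,
    [/\ abs_continuous a b x,
        x a = c &
        \forall t \ae mu_ab a b,
          is_derive (t : R) (1 : R) (x : R -> R) (Tp x t - Tm x t + F x t)].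
Proof.
have [d d0 d_le] := solv_poly_lower_bound hAB.
rewrite hA hB in d_le.
have ba : 0 <= b - a by rewrite subr_ge0 ltW.
have P0 := positive_op_norm_ge0 hab Tp_pos.
have Q0 := positive_op_norm_ge0 hab Tm_pos.
have K0 : 0 <= apriori_const ((b - a) * positive_op_norm Tm) d.
  by apply: apriori_const_ge0 => //; exact: mulr_ge0.
have [C1 [C2 [C10 C20 apriori]]] : exists C1 C2 : R, [/\ 0 <= C1, 0 <= C2 &
    forall x l, 0 <= l <= 1 -> x = l *: cauchy_map Tp Tm F c x ->
    `|x| <= C1 + C2 * `|F x|].
  set K := apriori_const _ _ in K0 *.
  exists (`|c| + K * ((b - a) *
      (`|c| * (positive_op_norm Tp + positive_op_norm Tm)))), (K * (b - a)).
  split; [by rewrite addr_ge0// !mulr_ge0// addr_ge0|exact: mulr_ge0|].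
  move=> x l l01 xE.
  have := cauchy_map_apriori hab Tp_pos Tm_pos d0 d_le l01 xE.
  move=> /le_trans; apply.
  by rewrite -/K le_eqVlt; apply/orP; left; apply/eqP; ring.
(* With [C2 * eta <= 1 / 2], the a priori bound becomes [`|x| <= 2 * C1] as
   soon as [`|F x| <= eta * `|x|], that is, for [`|x|] large. *)
pose eta := (2 * (C2 + 1))^-1.
have eta0 : 0 < eta by rewrite invr_gt0 mulr_gt0// ltr_wpDl.
have C2eta : C2 * eta <= 2^-1.
  rewrite /eta ler_pdivrMr ?mulr_gt0 ?ltr_wpDl// mulKf ?pnatr_eq0//.
  by rewrite lerDl.
have [r0 _ r0P] := F_sublinear _ (nbhsx_ballx (0 : R) eta eta0).
have Fr0 (x : Cab a b) : r0 < `|x| -> `|F x| / `|x| < eta.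
  by move=> /r0P; rewrite /= -ball_normE /= sub0r normrN ger0_norm.
pose r := Num.max r0 (2 * C1) + 1.
have r0r : r0 < r by rewrite ltr_pwDr// le_max lexx.
have C1r : 2 * C1 < r by rewrite ltr_pwDr// le_max lexx orbT.
have rgt0 : 0 < r by apply: le_lt_trans C1r; rewrite mulr_ge0.
have [MF MF0 FMF] : exists2 MF : R, 0 <= MF &
    forall x : Cab a b, `|x| <= r -> `|F x| <= MF.
  have [|M [_ FM]] := F_bounded [set x | `|x| <= r].
    exists r; split; first exact: num_real.
    move=> s rs x /= xr. exact: le_trans xr (ltW rs).
  exists (`|M| + 1) => [|x xr]; first by rewrite addr_ge0.
  by apply: FM; [rewrite (le_lt_trans (ler_norm M))// ltrDl|exists x].
have [K cK KG] := cauchy_map_compact c hab Tp_pos Tm_pos (ltW rgt0) MF0 FMF.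
have [|x xE] := schaefer_fixed_point rgt0
    (cauchy_map_continuous (c := c) hab Tp_pos Tm_pos F_continuous) cK KG.
  move=> x l _ l01 xE; rewrite ltNge; apply/negP => rx.
  have xgt0 : 0 < `|x| by exact: lt_le_trans rx.
  have := Fr0 x (lt_le_trans r0r rx); rewrite /= ltr_pdivrMr// => Fx.
  have := apriori x l l01 xE.
  have : C2 * `|F x| <= `|x| / 2.
    rewrite (le_trans (ler_wpM2l C20 (ltW Fx)))// mulrA [X in _ <= X]mulrC.
    by rewrite ler_wpM2r.
  have := lt_le_trans C1r rx; lra.
exists x; split.
- rewrite -xE; apply: (@lipschitz_abs_continuous _ _ _ `|cauchy_rhs Tp Tm F x|) => //.
  exact: cauchy_map_lipschitz.
- rewrite -[in LHS]xE cauchy_mapE ?bound_itvE ?ltW//.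
  by rewrite Cab_prim_start ?addr0// ltW.
- near=> t; have tab : t \in `]a, b[ by near: t; exact: ae_itvoo.
  have <- : cauchy_rhs Tp Tm F x t = Tp x t - Tm x t + F x t.
    by near: t; exact: cauchy_rhsE.
  have prim_der : is_derive (t : R) (1 : R)
      (Cab_prim (cauchy_rhs Tp Tm F x) : R -> R)
      (cauchy_rhs Tp Tm F x t).
    by near: t; exact: Cab_prim_is_derive.
  apply: (@near_eq_is_derive _ _ _
    (cst c + (Cab_prim (cauchy_rhs Tp Tm F x) : R -> R))).
    near=> s; rewrite -[in RHS]xE cauchy_mapE//; apply: subset_itv_oo_cc.
    by near: s; exact: near_in_itvoo.
  rewrite -[X in is_derive _ _ _ X]add0r; exact: is_deriveD.
Unshelve. all: by end_near. Qed.
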